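(* Let $d\ge 2$ and $l\ge 2$ be integers and let $\epsilon\in[0,1/d)$; put $\delta:=\frac{\epsilon(d-1)}{1-\epsilon}$. Let $G$ be a finite connected, non-complete, non-bipartite graph on $n$ vertices whose edge set is partitioned into a family $\mathcal{K}$ of cliques, each of order $l$, such that every vertex lies in exactly $d$ cliques of $\mathcal{K}$ (so $G$ is $d(l-1)$-regular), with adjacency eigenvalues $d(l-1)=\lambda_1\ge\lambda_2\ge\cdots\ge\lambda_n$. Let $\tilde\rho$ be the mixing rate of the random walk $W_\epsilon$ on $G$. \begin{enumerate} \item If $l(1-\delta)\le d$ with $d\ge 3$ and $l\ge 2$, then $W_\epsilon$ converges to the uniform distribution and $$\tilde\rho=\sqrt{\frac{1-\delta}{(d-1+\delta)(l-1)}}\;\psi\Big(\frac{\lambda}{2\sqrt{(l-1)(1-\delta)(d-1+\delta)}}\Big),$$ where $\lambda:=\max_{i\in\{2,n\}}|\lambda_i-(l-2)(1-\delta)|$. Moreover, regarding $\tilde\rho$ as a function of $\epsilon$ on $[0,1/d]$ (where $\tilde\rho(1/d)$ is the mixing rate of $W_{1/d}$), $\tilde\rho(\epsilon)$ is continuous on $[0,1/d]$. \item If $l(1-\delta)>d$ with $d\ge 2$ and $l\ge 2$, then $W_\epsilon$ converges to the uniform distribution and $$\tilde\rho=\sqrt{\frac{1-\delta}{(d-1+\delta)(l-1)}}\;\psi\Big(\frac{\hat\lambda}{2\sqrt{(l-1)(1-\delta)(d-1+\delta)}}\Big),$$ where $\hat\lambda:=\max_{2\le i\le n,\ \lambda_i\neq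 -d}|\lambda_i-(l-2)(1-\delta)|$. \end{enumerate}
   Context: The random walk $W_\epsilon$ ($\epsilon\in[0,1/d]$) on the vertices of $G$: start at an arbitrary vertex; in the first step move to one of the $d(l-1)$ neighbors chosen uniformly at random. In each subsequent step, with probability $\epsilon$ move to a uniformly chosen one of the $l-1$ other vertices of the clique of $\mathcal{K}$ containing the most recently traversed edge, and with probability $1-\epsilon$ move to a uniformly chosen one of the remaining $(d-1)(l-1)$ neighbors (those not in that clique). Writing $\tilde P^{(k)}_{uv}=\mathbb{P}(X_k=v\mid X_0=u)$, the mixing rate is $\tilde\rho=\limsup_{k\to\infty}\max_{u,v}|\tilde P^{(k)}_{uv}-\frac1n|^{1/k}$; ''converges to the uniform distribution'' means $\tilde P^{(k)}_{uv}\to 1/n$ for all $u,v$. The function $\psi:[0,\infty)\to\mathbb{R}$ is $\psi(x)=1$ for $0\le x\le 1$ and $\psi(x)=x+\sqrt{x^2-1}$ for $x\ge 1$. *)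

(* Defs.v *)
From HB Require Import structures.
From mathcomp Require Import all_boot all_order all_algebra.
From mathcomp Require Import all_classical all_reals all_analysis.

Set Implicit Arguments.
Unset Strict Implicit.
Unset Printing Implicit Defensive.

Import Order.TTheory GRing.Theory Num.Theory.
Import numFieldNormedType.Exports.

Local Open Scope ring_scope.

Section Graphs.
Variables (T : finType) (e : rel T).

Definition simple_graph : Prop := symmetric e /\ irreflexive e.

Definition connected_graph : Prop := forall x y, connect e x y.

Definition complete_graph : Prop := forall x y, x != y -> e x y.

Definition bipartite_graph : Prop :=
  exists side : T -> bool, forall x y, e x y -> side x != side y.

Definition is_clique (C : {set T}) : Prop :=
  forall x y, x \in C -> y \in C -> x != y -> e x y.

(* K : {set {set T}} carries no multiplicities; this loses nothing for l >= 2,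
   since two equal members would then share an edge. *)
Definition clique_partition (d l : nat) (K : {set {set T}}) : Prop :=
  [/\ forall C : {set T}, C \in K -> is_clique C /\ #|C| = l,
      forall x y, e x y ->
        exists! C : {set T}, C \in K /\ (x \in C /\ y \in C) &
      forall x, #|[set C in K | x \in C]| = d].

End Graphs.

Section Spectrum.
Variable R : realType.

Definition adjacency_matrix (T : finType) (e : rel T) : 'M[R]_#|T| :=
  \matrix_(i, j) (e (enum_val i) (enum_val j))%:R.

(* lam lists the eigenvalues in nonincreasing order, repeated according to
   algebraic multiplicity (all of them are real when A is symmetric). *)
Definition is_spectrum n (A : 'M[R]_n) (lam : seq R) : Prop :=
  sorted >=%R lam /\ char_poly A = \prod_(x <- lam) ('X - x%:P).

(* 1-based: eig lam i is lambda_i *)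
Definition eig (lam : seq R) (i : nat) : R := lam`_i.-1.

End Spectrum.

Section Walk.
Variables (R : realType) (T : finType) (e : rel T) (K : {set {set T}}).
Variable eps : R.

(* the uniform probability mass function on A (zero if A is empty) *)
Definition uniform_on (A : {set T}) (z : T) : R := (z \in A)%:R / #|A|%:R.

Definition neighbours (y : T) : {set T} := [set z | e y z].

Definition edge_clique (x y : T) : {set T} :=
  odflt finset.set0 [pick C in K | (x \in C) && (y \in C)].

(* P(X_{k+2} = z | X_k = x, X_{k+1} = y): the walk has just traversed xy *)
Definition walk_step (x y z : T) : R :=
  let C := edge_clique x y in
  eps * uniform_on (C :\ y)%SET z
  + (1 - eps) * uniform_on (neighbours y :\: C)%SET z.

Fixpoint walk_tail (x y : T) (s : seq T) : R :=
  if s is z :: s' then walk_step x y z * walk_tail y z s' else 1.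

(* the law of the walk: P(X_1 = s_1, ..., X_k = s_k | X_0 = u) *)
Definition trajectory_prob (u : T) (s : seq T) : R :=
  if s is y :: s' then uniform_on (neighbours u) y * walk_tail u y s' else 1.

(* P(X_k = v | X_0 = u) *)
Definition walk_prob (k : nat) (u v : T) : R :=
  \sum_(s : k.-tuple T | last u s == v) trajectory_prob u s.

Definition converges_to_uniform : Prop :=
  forall u v, (walk_prob k u v @[k --> \oo] --> (#|T|%:R^-1 : R))%classic.

Definition mixing_rate : R :=
  limn_sup (fun k : nat =>
    \big[Num.max/0]_(p : T * T)
      (`|walk_prob k p.1 p.2 - #|T|%:R^-1| `^ k%:R^-1)).

End Walk.

Definition psi (R : realType) (x : R) : R :=
  if x <= 1 then 1 else x + Num.sqrt (x ^+ 2 - 1).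

(* Main.v *)
(* Let D = d(l-1), b = (1-eps)/((d-1)(l-1)) and s = (1-d eps)/((d-1)(l-1)).
   The law of the next step depends on the past only through the clique of the
   last edge, and the matrices P_k of the k-step probabilities satisfy
     P_0 = 1,  P_1 = A/D,  P_{k+2} = (b A - (l-2) s) P_{k+1} - s P_k.
   Diagonalizing A, an eigenvalue mu contributes the scalar sequence with
   p_0 = 1, p_1 = mu/D and characteristic polynomial X^2 - (b mu - (l-2) s) X + s.
   Its growth rate is the larger root modulus, unless p_1 is itself a root; that
   happens only for mu = D (where p_k = 1, the uniform distribution) and for
   mu = -d, where p_k = (-1/(l-1))^k. For mu = -d the root -1/(l-1) is dominant
   exactly when l(1-delta) <= d, whence the two cases; otherwise it is smaller
   than sqrt s and hence than the rate of any other eigenvalue. Since 1/(l-1)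
   does not depend on eps, the mixing rate is continuous across the two cases. *)
Require Import Defs.
From HB Require Import structures.
From mathcomp Require Import all_boot all_order all_algebra.
From mathcomp Require Import all_classical all_reals all_analysis.
From mathcomp Require Import ring lra.

Set Implicit Arguments.
Unset Strict Implicit.
Unset Printing Implicit Defensive.

Import Order.TTheory GRing.Theory Num.Theory.
Import numFieldNormedType.Exports.

Local Open Scope classical_set_scope.
Local Open Scope ring_scope.

(** * Growth rates of linear recurrences *)

Section Growth.
Variable R : realType.
Implicit Types (p : nat -> R) (r s t x : R).

(** The upper bound leaves the slack [r < r'] to absorb a polynomial factor at a double root; the
    lower bound is asked only for infinitely many [k], since an oscillating sequence can come close
    to zero. *)
Definition growth_rate p r :=
  (forall r', r < r' -> exists C, forall k, `|p k| <= C * r' ^+ k) /\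
  (exists2 c, 0 < c & forall N, exists2 k, (N <= k)%N & c * r ^+ k <= `|p k|).

Lemma growth_rate_expr x : growth_rate (fun k => x ^+ k) `|x|.
Proof.
split=> [r' ltr|].
  exists 1 => k; rewrite mul1r normrX lerXn2r ?nnegrE ?(ltW ltr)//.
  exact: le_trans (ltW ltr).
by exists 1 => // N; exists N; rewrite // mul1r normrX.
Qed.

(** Meant for oscillating sequences, where one term may be small but not two neighbours. If the
    bound falls on [p k.+1], the index shift costs a factor [r], whence the constant [c / r]. *)
Lemma two_term_lower p r c : 0 < r -> 0 < c ->
    (forall k, c * r ^+ k <= Num.max `|p k| `|p k.+1|) ->
  exists2 c', 0 < c' & forall N, exists2 k, (N <= k)%N & c' * r ^+ k <= `|p k|.
Proof.
move=> r0 c0 h; exists (Num.min c (c / r)); first by rewrite lt_min c0 divr_gt0.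
move=> N; have := h N; rewrite le_max => /orP[h1|h1].
  exists N => //; apply: le_trans h1.
  by rewrite ler_wpM2r ?exprn_ge0 ?(ltW r0)// ge_min lexx.
exists N.+1; first exact: leqnSn.
apply: le_trans h1; rewrite exprS mulrA ler_wpM2r ?exprn_ge0 ?(ltW r0)//.
by rewrite -ler_pdivlMr// ge_min lexx orbT.
Qed.

(* the larger modulus of a root of [X^2 - t X + s]; [Num.sqrt] vanishes on
   negative numbers, so non-real roots are covered too *)
Definition root_radius t s : R :=
  (Num.max `|t| (2 * Num.sqrt s) + Num.sqrt (t ^+ 2 - 4 * s)) / 2.

Lemma root_radius_nonreal t s : 0 <= s -> t ^+ 2 <= 4 * s ->
  root_radius t s = Num.sqrt s.
Proof.
move=> s0 h; rewrite /root_radius (@ler0_sqrtr _ (_ - _)) ?subr_le0// addr0.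
rewrite max_r; first by rewrite mulrC mulrA mulVf ?mul1r.
rewrite -ler_sqr ?nnegrE ?mulr_ge0 ?sqrtr_ge0// real_normK ?num_real//.
by rewrite exprMn sqr_sqrtr// -natrX.
Qed.

Lemma root_radius_real t s : 0 <= s -> 4 * s <= t ^+ 2 ->
  root_radius t s = (`|t| + Num.sqrt (t ^+ 2 - 4 * s)) / 2.
Proof.
move=> s0 h; rewrite /root_radius max_l//.
rewrite -ler_sqr ?nnegrE ?mulr_ge0 ?sqrtr_ge0// real_normK ?num_real//.
by rewrite exprMn sqr_sqrtr// -natrX.
Qed.

Lemma sqrt_le_root_radius t s : Num.sqrt s <= root_radius t s.
Proof.
have := sqrtr_ge0 (t ^+ 2 - 4 * s).
have : 2 * Num.sqrt s <= Num.max `|t| (2 * Num.sqrt s) by rewrite le_max lexx orbT.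
rewrite /root_radius; lra.
Qed.

Lemma root_radius_ge0 t s : 0 <= root_radius t s.
Proof. exact: le_trans (sqrtr_ge0 s) (sqrt_le_root_radius t s). Qed.

Lemma le_root_radius t t' s : `|t| <= `|t'| -> root_radius t s <= root_radius t' s.
Proof.
move=> h; have h2 : t ^+ 2 <= t' ^+ 2.
  by rewrite -(real_normK (num_real t)) -(real_normK (num_real t')) lerXn2r ?nnegrE.
rewrite /root_radius ler_pM2r ?invr_gt0// lerD//; last by rewrite ler_wsqrtr// lerB.
by rewrite ge_max le_max h /= le_max lexx orbT.
Qed.

Lemma real_rootsE t s : 0 <= s -> 4 * s <= t ^+ 2 ->
  exists z w, [/\ z + w = t, z * w = s, `|w| <= `|z| & `|z| = root_radius t s].
Proof.
move=> s0 h; rewrite root_radius_real//.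
set D := Num.sqrt _; have D0 : 0 <= D := sqrtr_ge0 _.
have D2 : D ^+ 2 = t ^+ 2 - 4 * s by rewrite sqr_sqrtr// subr_ge0.
have Dt : D <= `|t|.
  rewrite -ler_sqr ?nnegrE// real_normK ?num_real// D2; lra.
(* The root of larger modulus is the one in which [D] enters with the sign of [t]. *)
case: (ger0P t) Dt => t0 Dt.
  exists ((t + D) / 2), ((t - D) / 2).
  rewrite !ger0_norm; [|lra..]; split; [by field | | lra | by []].
  have -> : s = (t ^+ 2 - D ^+ 2) / 4 by rewrite D2; field.
  by field.
exists ((t - D) / 2), ((t + D) / 2).
rewrite !ler0_norm; [|lra..]; split; [by field | | lra | lra].
have -> : s = (t ^+ 2 - D ^+ 2) / 4 by rewrite D2; field.
by field.
Qed.

Lemma linear_rec_bound p w r C : 0 <= C -> `|w| < r ->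
    (forall k, `|p k.+1 - w * p k| <= C * r ^+ k) ->
  exists C', forall k, `|p k| <= C' * r ^+ k.
Proof.
move=> C0 wr h; have r0 : 0 < r := le_lt_trans (normr_ge0 w) wr.
have rw : 0 < r - `|w| by rewrite subr_gt0.
(* The summand [C / (r - |w|)] is the fixed point of [x -> (C + |w| x) / r], so the bound reproduces
   itself. *)
exists (`|p 0%N| + C / (r - `|w|)); elim=> [|k IH].
  by rewrite expr0 mulr1 lerDl divr_ge0// ltW.
rewrite -(subrK (w * p k) (p k.+1)); apply: le_trans (ler_normD _ _) _.
apply: le_trans (lerD (h k) _) _; first by rewrite normrM; exact: ler_wpM2l IH.
rewrite exprS !mulrA -mulrDl ler_wpM2r ?exprn_ge0 ?(ltW r0)//.
have -> : C + `|w| * (`|p 0%N| + C / (r - `|w|)) =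
   `|w| * `|p 0%N| + C / (r - `|w|) * r by field; rewrite gt_eqF.
by rewrite mulrDl lerD2r mulrC ler_wpM2l// ltW.
Qed.

(* [q] is multiplied by [s] at each step, and is a definite quadratic form in
   two consecutive terms when the roots are not real; for real roots [z], [w]
   the sequence [p k.+1 - w * p k] is geometric of ratio [z]. *)
Lemma growth_rate_rec p t s : 0 < s ->
    (forall k, p k.+2 = t * p k.+1 - s * p k) ->
    p 1%N ^+ 2 - t * p 1%N * p 0%N + s * p 0%N ^+ 2 != 0 ->
  growth_rate p (root_radius t s).
Proof.
move=> s0 rec; set q := fun k => p k.+1 ^+ 2 - t * p k.+1 * p k + s * p k ^+ 2.
rewrite -[X in X != 0]/(q 0%N) => q0.
have sr0 : 0 < Num.sqrt s by rewrite sqrtr_gt0.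
case: (ltP (t ^+ 2) (4 * s)) => [lt4|ge4]; last first.
  have [z [w [tE sE wz zr]]] := real_rootsE (ltW s0) ge4.
  have diff k : p k.+1 - w * p k = z ^+ k * (p 1%N - w * p 0%N).
    elim: k => [|k IH]; first by rewrite mul1r.
    by rewrite exprS -mulrA -IH rec -tE -sE; ring.
  have r0 : 0 < `|z| by rewrite zr (lt_le_trans sr0) ?sqrt_le_root_radius.
  (* [q 0] factors over the two roots, so [q 0 != 0] gives a nonzero component along the dominant
     root [z]. *)
  have d0 : 0 < `|p 1%N - w * p 0%N|.
    rewrite normr_gt0; apply: contra_neq q0 => e.
    have -> : q 0%N = (p 1%N - w * p 0%N) * (p 1%N - z * p 0%N).
      by rewrite /q -tE -sE; ring.
    by rewrite e mul0r.
  rewrite -zr; split=> [r' zr'|].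
    apply: (@linear_rec_bound _ w _ `|p 1%N - w * p 0%N|) => // [|k].
      exact: le_lt_trans wz zr'.
    rewrite (diff k) normrM [X in X <= _]mulrC ler_wpM2l// normrX lerXn2r ?nnegrE ?(ltW zr')//.
    exact: le_trans (ltW zr').
  (* The geometric sequence [p k.+1 - w * p k] is at most [1 + |w|] times the larger of the two
     terms. *)
  apply: (@two_term_lower _ _ (`|p 1%N - w * p 0%N| / (1 + `|w|))) => // [|k].
    by rewrite divr_gt0// ltr_pwDl.
  rewrite mulrAC ler_pdivrMr ?ltr_pwDl// -normrX -normrM [X in `|X|]mulrC -(diff k).
  apply: le_trans (ler_normB _ _) _; rewrite normrM mulrDr mulr1.
  rewrite lerD// ?le_max ?lexx ?orbT// mulrC ler_wpM2r// le_max lexx//.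
have qE k : q k = (Num.sqrt s ^+ k) ^+ 2 * q 0%N.
  rewrite exprAC sqr_sqrtr ?ltW//; elim: k => [|k IH]; first by rewrite mul1r.
  by rewrite exprS -mulrA -IH /q rec; ring.
rewrite root_radius_nonreal ?ltW//; split=> [r' rr'|].
  (* Completing the square gives [(s - t^2 / 4) p_k^2 <= q k], with a positive coefficient because
     the roots are not real. *)
  exists (Num.sqrt (`|q 0%N| / (s - t ^+ 2 / 4))) => k.
  have d0 : 0 < s - t ^+ 2 / 4 by lra.
  apply: (@le_trans _ _ (Num.sqrt (`|q 0%N| / (s - t ^+ 2 / 4)) * Num.sqrt s ^+ k)).
    rewrite -ler_sqr ?nnegrE ?mulr_ge0 ?exprn_ge0 ?sqrtr_ge0//.
    rewrite exprMn sqr_sqrtr ?divr_ge0 ?(ltW d0)// real_normK ?num_real//.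
    rewrite mulrAC ler_pdivlMr//; apply: (@le_trans _ _ (q k)).
      rewrite /q -subr_ge0.
      have -> : p k.+1 ^+ 2 - t * p k.+1 * p k + s * p k ^+ 2 -
        p k ^+ 2 * (s - t ^+ 2 / 4) = (p k.+1 - t / 2 * p k) ^+ 2 by field.
      exact: sqr_ge0.
    by rewrite qE mulrC ler_wpM2r ?sqr_ge0// ler_norm.
  by rewrite ler_wpM2l ?sqrtr_ge0// lerXn2r ?nnegrE ?(ltW sr0) ?(ltW rr')// ltW// (lt_trans sr0).
(* Conversely [|q k|] is at most [B] times the square of the larger of two consecutive terms. *)
set B := 1 + `|t| + s; have B0 : 0 < B by rewrite addr_gt0// ltr_pwDl.
apply: (@two_term_lower _ _ (Num.sqrt (`|q 0%N| / B))) => // [|k].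
  by rewrite sqrtr_gt0 divr_gt0// normr_gt0.
set m := Num.max _ _.
have m0 : 0 <= m by rewrite /m le_max normr_ge0.
have m1 : `|p k| <= m by rewrite /m le_max lexx.
have m2 : `|p k.+1| <= m by rewrite /m le_max lexx orbT.
rewrite -ler_sqr ?nnegrE ?mulr_ge0 ?exprn_ge0 ?sqrtr_ge0//.
rewrite exprMn sqr_sqrtr ?divr_ge0 ?(ltW B0)//.
rewrite mulrAC ler_pdivrMr// -[X in _ * X]ger0_norm ?sqr_ge0// -normrM mulrC -qE /q.
apply: le_trans (ler_normD _ _) _; rewrite /B mulrDr mulrDr mulr1 lerD//.
  apply: le_trans (ler_normB _ _) _; rewrite lerD//.
    by rewrite normrX lerXn2r ?nnegrE.
  by rewrite !normrM -mulrA mulrC ler_wpM2r// expr2 ler_pM.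
by rewrite normrM (gtr0_norm s0) mulrC ler_wpM2r ?(ltW s0)// normrX lerXn2r ?nnegrE.
Qed.

Lemma limn_sup_eq (u : nat -> R) (x : R) :
    (forall y, 0 < y -> \forall k \near \oo, u k <= x + y) ->
    (forall y N, 0 < y -> exists2 k, (N <= k)%N & x - y <= u k) ->
  limn_sup u = x.
Proof.
move=> hu hl; apply/cvg_lim => //; apply/cvgrPdist_le => y y0.
have [N _ hN] := hu _ y0.
exists N => // n /= Nn.
have ub : ubound (sdrop u n) (x + y).
  by move=> _ [k /= nk <-]; apply: hN => /=; exact: leq_trans nk.
rewrite ler_distlC; apply/andP; split.
  have [k nk ku] := hl _ n y0; apply: le_trans ku _.
  by apply: ub_le_sup; [exists (x + y) | exists k].
by apply: ge_sup => //; exists (u n); exists n => /=.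
Qed.

Lemma cvg_powR_invn x : 0 < x -> x `^ k%:R^-1 @[k --> \oo] --> (1 : R).
Proof.
move=> x0; have -> : (fun k : nat => x `^ k%:R^-1) = fun k => expR (k%:R^-1 * ln x).
  by apply/funext => k; rewrite /powR gt_eqF.
suff : expR (k%:R^-1 * ln x) @[k --> \oo] --> expR (0 * ln x) by rewrite mul0r expR0.
apply: continuous_cvg; first exact: continuous_expR.
apply: cvgMr_tmp.
have h : (n.+1%:R^-1 : R) @[n --> \oo] --> (0 : R) := cvg_harmonic.
by rewrite -(cvg_shiftS (fun k : nat => k%:R^-1 : R)).
Qed.

(* Constant factors disappear under k-th roots. *)
Lemma limn_sup_root (I : finType) (M : nat -> I -> R) x : 0 <= x ->
    (forall y, x < y -> exists C, forall k i, `|M k i| <= C * y ^+ k) ->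
    (exists2 c, 0 < c &
       forall N, exists2 k, (N <= k)%N & exists i, c * x ^+ k <= `|M k i|) ->
  limn_sup (fun k => \big[Num.max/0]_i (`|M k i| `^ k%:R^-1)) = x.
Proof.
move=> x0 hu [c c0 hl]; apply: limn_sup_eq => [y y0|y N y0].
  have xy : x < x + y / 2 by rewrite ltrDl divr_gt0.
  have xy0 : 0 < x + y / 2 := le_lt_trans x0 xy.
  have [C hC] := hu _ xy.
  (* A positive constant has k-th roots tending to 1. The tolerance below solves
     [(1 + tol) (x + y / 2) = x + y]. *)
  set C' := Num.max C 1; have C'0 : 0 < C' by rewrite lt_max ltr01 orbT.
  have e0 : 0 < y / 2 / (x + y / 2) by rewrite !divr_gt0.
  move/cvgrPdist_le: (cvg_powR_invn C'0) => /(_ _ e0) [N _ hN].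
  (* The index 0 is skipped: its exponent [0^-1] is 0, so no root is taken there. *)
  exists N.+1 => // -[//|k] /= Nk.
  apply: (big_ind (fun z => z <= x + y)) => [|a b ha hb|i _].
  - exact: addr_ge0 (ltW y0).
  - by rewrite ge_max ha hb.
  apply: (@le_trans _ _ ((C' * (x + y / 2) ^+ k.+1) `^ k.+1%:R^-1)).
    apply: ge0_ler_powR; rewrite ?nnegrE ?invr_ge0 ?mulr_ge0 ?exprn_ge0 ?(ltW C'0) ?(ltW xy0)//.
    apply: le_trans (hC _ i) _; rewrite ler_wpM2r ?exprn_ge0 ?(ltW xy0)//.
    by rewrite le_max lexx.
  rewrite powRM ?exprn_ge0 ?(ltW xy0) ?(ltW C'0)// -powR_mulrn ?(ltW xy0)// -powRrM divff// powRr1 ?(ltW xy0)//.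
  have := hN k.+1 (ltnW Nk); rewrite ler_distlC => /andP[_ h].
  apply: le_trans (ler_wpM2r (ltW xy0) h) _.
  by rewrite mulrDl mul1r divfK ?gt_eqF//; lra.
(* For [x = 0] the lower bound is immediate, as the maximum starts from 0; otherwise [y / x] is a
   legitimate tolerance. *)
have [x_eq0|x_neq0] := eqVneq x 0.
  exists N => //; rewrite x_eq0 sub0r (@le_trans _ _ 0) ?oppr_le0 ?(ltW y0)//.
  by apply: bigmax_ge_id.
have xp : 0 < x by rewrite lt_neqAle eq_sym x_neq0.
move/cvgrPdist_le: (cvg_powR_invn c0) => /(_ (y / x)).
rewrite divr_gt0// => /(_ isT) [N' _ hN].
have [k Nk [i hi]] := hl (maxn N N').+1.
have k0 : (0 < k)%N by apply: leq_trans Nk.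
exists k; first by rewrite (leq_trans _ (ltnW Nk)) ?leq_maxl.
apply: le_trans (le_bigmax _ _ i).
apply: (@le_trans _ _ ((c * x ^+ k) `^ k%:R^-1)); last first.
  by apply: ge0_ler_powR; rewrite ?nnegrE ?invr_ge0 ?mulr_ge0 ?exprn_ge0 ?(ltW c0).
rewrite powRM ?exprn_ge0 ?(ltW c0)// -powR_mulrn// -powRrM divff ?pnatr_eq0 -?lt0n//.
rewrite powRr1//.
have := hN k; rewrite /= (leq_trans _ (ltnW Nk)) ?leq_maxr// => /(_ isT).
rewrite ler_distlC => /andP[h _].
by apply: le_trans (ler_wpM2r (ltW xp) h); rewrite mulrBl mul1r divfK.
Qed.

End Growth.

(** * The recurrence for the walk *)

Section CliqueWalk.
Variables (R : realType) (T : finType) (e : rel T) (K : {set {set T}}).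
Variables (d l : nat).
Hypotheses (hd : (2 <= d)%N) (hl : (2 <= l)%N).
Hypotheses (hG : simple_graph e) (hK : clique_partition e d l K).

Let Kclique C : C \in K -> is_clique e C.
Proof. by case: hK => h _ _ /h[]. Qed.

Let Kcard C : C \in K -> #|C| = l.
Proof. by case: hK => h _ _ /h[]. Qed.

Lemma clique_unique C C' x y : C \in K -> C' \in K -> x \in C -> y \in C ->
  x \in C' -> y \in C' -> x != y -> C = C'.
Proof.
move=> CK C'K xC yC xC' yC' xy.
have exy : e x y := Kclique CK xC yC xy.
case: hK => _ /(_ _ _ exy) [C0 [_ u]] _.
by rewrite -(u C) // -(u C').
Qed.

Lemma edge_cliqueE C x y : C \in K -> x \in C -> y \in C -> x != y ->
  edge_clique K x y = C.
Proof.
move=> CK xC yC xy; rewrite /edge_clique.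
case: pickP => [C' /and3P[C'K xC' yC']|/(_ C)] /=.
  exact: clique_unique xC' yC' xC yC xy.
by rewrite CK xC yC.
Qed.

(** The cliques through [y], with [y] removed, partition its neighbourhood: each edge at [y] lies in
    exactly one of them. *)
Lemma sum_neighbours (V : nmodType) y (F : T -> V) :
  \sum_(z | e y z) F z = \sum_(C in K | y \in C) \sum_(z in C | z != y) F z.
Proof.
rewrite (exchange_big_dep (fun z => e y z)) /=; last first.
  by move=> C z /andP[CK yC] /andP[zC zy]; apply: (Kclique CK); rewrite // 1?eq_sym//.
apply: eq_bigr => z eyz.
have yz : z != y by apply: contraTneq eyz => ->; rewrite (hG.2 y).
case: hK => _ /(_ _ _ eyz) [C [[CK [yC zC]] u]] _.
rewrite (big_pred1 C)// => C' /=.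
rewrite yz andbT; apply/idP/eqP => [/andP[/andP[C'K yC'] zC']|->].
  by rewrite -(u C').
by rewrite CK yC zC.
Qed.

Lemma sum_clique_const (V : nmodType) (c : V) C y : C \in K -> y \in C ->
  \sum_(z in C | z != y) c = c *+ l.-1.
Proof.
move=> CK yC; rewrite -(Kcard CK) (cardsD1 y) yC /= -sumr_const.
by apply: eq_bigl => z; rewrite !inE andbC.
Qed.

Lemma sum_cliques_const (V : nmodType) (c : V) y :
  \sum_(C in K | y \in C) c = c *+ d.
Proof.
case: hK => _ _ /(_ y) <-; rewrite -sumr_const.
by apply: eq_bigl => C; rewrite !inE.
Qed.

Lemma card_neighbours y : #|neighbours e y| = (d * l.-1)%N.
Proof.
rewrite -sum1_card (eq_bigl (fun z => e y z)) => [|z]; last by rewrite !inE.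
rewrite sum_neighbours (eq_bigr (fun=> l.-1)) => [|C /andP[CK yC]].
  by rewrite sum_cliques_const mulnC; elim: d => [|m IH]; rewrite ?muln0// mulrS IH mulnS.
rewrite sum_clique_const //.
by elim: l.-1 => // m IH; rewrite mulrS IH.
Qed.

Lemma card_clique_rest C y : C \in K -> y \in C -> #|(C :\ y)%SET| = l.-1.
Proof. by move=> CK yC; rewrite -(Kcard CK) (cardsD1 y C) yC. Qed.

Lemma card_other_neighbours C y : C \in K -> y \in C ->
  #|(neighbours e y :\: C)%SET| = (d.-1 * l.-1)%N.
Proof.
move=> CK yC; rewrite cardsD card_neighbours.
have -> : (neighbours e y :&: C)%SET = (C :\ y)%SET.
  apply/setP => z; rewrite !inE andbC; apply/andP/andP => -[].
    by move=> zC eyz; split=> //; apply: contraTneq eyz => ->; rewrite (hG.2 y).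
  by move=> zy zC; split=> //; apply: (Kclique CK); rewrite // 1?eq_sym//.
by rewrite card_clique_rest// -[d in LHS](prednK (ltnW hd)) mulSn addKn.
Qed.

Variable eps : R.

Let D : R := d%:R * (l%:R - 1).
(** [a] and [b] are the probabilities of stepping to one given vertex inside and outside the clique
    of the last edge; [a - b] is the [- s] of the recurrence. *)
Let a : R := eps / (l%:R - 1).
Let b : R := (1 - eps) / ((d%:R - 1) * (l%:R - 1)).

Let l1 : (l.-1)%:R = l%:R - 1 :> R.
Proof. by rewrite -subn1 natrB// ltnW. Qed.

Let d1 : (d.-1)%:R = d%:R - 1 :> R.
Proof. by rewrite -subn1 natrB// ltnW. Qed.

Let l1_neq0 : l%:R - 1 != 0 :> R.
Proof. by rewrite -l1 pnatr_eq0 -lt0n -ltnS prednK// ltnW. Qed.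

Let d1_neq0 : d%:R - 1 != 0 :> R.
Proof. by rewrite -d1 pnatr_eq0 -lt0n -ltnS prednK// ltnW. Qed.

Let d_neq0 : d%:R != 0 :> R.
Proof. by rewrite pnatr_eq0 -lt0n ltnW. Qed.

Let D_neq0 : D != 0. Proof. by rewrite mulf_neq0. Qed.

Lemma walk_stepE C x y z : C \in K -> x \in C -> y \in C -> x != y ->
  walk_step e K eps x y z = if (z \in C) && (z != y) then a
                            else if e y z then b else 0.
Proof.
move=> CK xC yC xy; rewrite /walk_step (edge_cliqueE CK xC yC xy) /uniform_on.
rewrite card_clique_rest// card_other_neighbours// natrM l1 d1 !inE.
have [->|zy] := eqVneq z y.
  by rewrite (hG.2 y) /= !andbF !mul0r !mulr0 addr0.
have [zC|zC] /= := boolP (z \in C).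
  by rewrite !mul0r mulr0 addr0 mul1r.
rewrite mul0r mulr0 add0r; case: ifP => _; last by rewrite mul0r mulr0.
by rewrite mul1r.
Qed.

(* [clique_walk v k C y]: the probability that a walk that has just arrived at
   [y] along an edge of the clique [C] is at [v] after [k] further steps *)
Fixpoint clique_walk (v : T) k (C : {set T}) (y : T) : R :=
  if k is k'.+1 then
    a * (\sum_(z in C | z != y) clique_walk v k' C z)
    + b * (\sum_(C' in K | y \in C') \sum_(z in C' | z != y) clique_walk v k' C' z
           - \sum_(z in C | z != y) clique_walk v k' C z)
  else (y == v)%:R.

Lemma sum_tuple_cons n (F : n.+1.-tuple T -> R) :
  \sum_(t : n.+1.-tuple T) F t = \sum_(z : T) \sum_(t : n.-tuple T) F [tuple of z :: t].
Proof.
rewrite pair_big /= (reindex (fun p : T * n.-tuple T => [tuple of p.1 :: p.2])) //=.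
exists (fun t => (thead t, [tuple of behead t])) => [[z t] _|t _] /=.
  by congr pair; apply: val_inj.
by rewrite -tuple_eta.
Qed.

(** The vertex [x] enters [walk_step] only through the clique it shares with [y], so the walk is
    Markov on pairs of a clique and a vertex in it. *)
Lemma sum_walk_tail v k C x y : C \in K -> x \in C -> y \in C -> x != y ->
  \sum_(s : k.-tuple T | last y s == v) walk_tail e K eps x y s = clique_walk v k C y.
Proof.
elim: k C x y => [|k IH] C x y CK xC yC xy.
  rewrite big_mkcond (big_pred1 [tuple]) => [|t]; last exact/esym/eqP/tuple0.
  by rewrite /=; case: eqP.
rewrite big_mkcond sum_tuple_cons /=.
transitivity (\sum_(z | e y z) (if z \in C then a else b) * clique_walk v k (edge_clique K y z) z).
  rewrite [RHS]big_mkcond; apply: eq_bigr => z _.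
  rewrite -big_mkcond -mulr_sumr (walk_stepE z CK xC yC xy).
  case: (boolP (e y z)) => eyz; last first.
    case: ifP => [/andP[zC zy]|_]; last by rewrite mul0r.
    by case/negP: eyz; apply: (Kclique CK); rewrite // 1?eq_sym//.
  have yz : y != z by apply: contraTneq eyz => ->; rewrite (hG.2 z).
  have [C' [[C'K [yC' zC']] _]] : exists! C : {set T}, C \in K /\ (y \in C /\ z \in C).
    by case: hK => _ h _; exact: h.
  rewrite (IH C')// (edge_cliqueE C'K)// eq_sym yz andbT.
  by case: ifP.
rewrite sum_neighbours !mulr_sumr.
(* The clique [C] carries the weight [a]; every other clique through [y] meets [C] in [y] alone and
   carries [b]. *)
rewrite (bigD1 C) ?CK//= [X in _ = _ + b * (X - _)](bigD1 C) ?CK//=.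
rewrite [X in b * X]addrAC subrr add0r mulr_sumr; congr (_ + _).
  by apply: eq_bigr => z /andP[zC zy]; rewrite zC (edge_cliqueE CK)// eq_sym.
apply: eq_bigr => C' /andP[/andP[C'K yC'] C'C]; rewrite mulr_sumr.
apply: eq_bigr => z /andP[zC' zy]; rewrite (edge_cliqueE C'K)// 1?eq_sym//.
case: ifP => // zC; case/eqP: C'C.
by apply: (clique_unique C'K CK yC' zC' yC zC); rewrite eq_sym.
Qed.

Lemma walk_prob0 u v : walk_prob e K eps 0 u v = (u == v)%:R.
Proof.
rewrite /walk_prob big_mkcond (big_pred1 [tuple]) => [|t]; last exact/esym/eqP/tuple0.
by rewrite /=; case: eqP.
Qed.

Lemma walk_probS k u v : walk_prob e K eps k.+1 u v =
  D^-1 * \sum_(C in K | u \in C) \sum_(y in C | y != u) clique_walk v k C y.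
Proof.
rewrite /walk_prob big_mkcond sum_tuple_cons /= mulr_sumr.
transitivity (\sum_(y | e u y) D^-1 * clique_walk v k (edge_clique K u y) y).
  rewrite [RHS]big_mkcond; apply: eq_bigr => y _.
  rewrite -big_mkcond -mulr_sumr /uniform_on card_neighbours natrM l1 inE.
  case: (boolP (e u y)) => euy; last by rewrite !mul0r.
  have uy : u != y by apply: contraTneq euy => ->; rewrite (hG.2 y).
  have [C' [[C'K [uC' yC']] _]] : exists! C : {set T}, C \in K /\ (u \in C /\ y \in C).
    by case: hK => _ h _; exact: h.
  by rewrite (sum_walk_tail _ _ C'K)// (edge_cliqueE C'K)// mul1r.
rewrite sum_neighbours; apply: eq_bigr => C /andP[CK uC]; rewrite mulr_sumr.
by apply: eq_bigr => z /andP[zC zu]; rewrite (edge_cliqueE CK)// eq_sym.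
Qed.

(* A step of the walk is a step of weight [b] to an arbitrary neighbour,
   corrected by [a - b] inside the clique of the last edge. *)
Lemma clique_walkS v k C y : clique_walk v k.+1 C y =
  b * D * walk_prob e K eps k.+1 y v
  + (a - b) * \sum_(z in C | z != y) clique_walk v k C z.
Proof.
by rewrite /= walk_probS -mulrA mulVKf//; ring.
Qed.

(** Averaging over the [d] cliques through [u] makes the next step uniform, since
    [(l - 1) (a + (d - 1) b) = 1]: the memory of the last edge is lost. *)
Lemma sum_cliques_at k u v :
  \sum_(C in K | u \in C) (l%:R - 1) * clique_walk v k C u = D * walk_prob e K eps k u v.
Proof.
case: k => [|k].
  by rewrite walk_prob0 /= sum_cliques_const -mulr_natl /D; ring.
under eq_bigr do rewrite clique_walkS.
rewrite -mulr_sumr big_split /= sum_cliques_const -mulr_sumr.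
have -> : \sum_(C in K | u \in C) \sum_(z in C | z != u) clique_walk v k C z =
  D * walk_prob e K eps k.+1 u v by rewrite walk_probS mulVKf.
rewrite -mulr_natl /a /b /D; field; by rewrite ?l1_neq0 ?d1_neq0.
Qed.

(** Two steps inside a clique return to [u] through any of [l - 1] vertices, and reach any other
    given vertex through [l - 2]. *)
Lemma sum_double_clique C u (F : T -> R) : C \in K -> u \in C ->
  \sum_(y in C | y != u) \sum_(z in C | z != y) F z =
  (l%:R - 1) * F u + (l%:R - 2) * \sum_(z in C | z != u) F z.
Proof.
move=> CK uC.
have S y : y \in C -> \sum_(z in C | z != y) F z = \sum_(z in C) F z - F y.
  by move=> yC; rewrite [\sum_(z in C) _](bigD1 y)//= addrAC subrr add0r.
under eq_bigr => y /andP[yC _] do rewrite S//.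
rewrite sumrB sum_clique_const// S// -[_ *+ l.-1]mulr_natl l1.
ring.
Qed.

(** Expanding by [clique_walkS] after the first step, the part of weight [b] yields the adjacency
    operator, while the correction [a - b] makes two steps in one clique. The returns to [u] then
    produce the probabilities at time [k], the other endpoints those at time [k + 1]. *)
Lemma walk_prob_rec k u v : walk_prob e K eps k.+2 u v =
  b * (\sum_(y | e u y) walk_prob e K eps k.+1 y v)
  + (a - b) * (l%:R - 2) * walk_prob e K eps k.+1 u v
  + (a - b) * walk_prob e K eps k u v.
Proof.
rewrite [LHS]walk_probS.
under eq_bigr => C /andP[CK uC].
  under eq_bigr do rewrite clique_walkS.
  rewrite big_split /= -!mulr_sumr sum_double_clique//.
  over.
rewrite big_split /= -!mulr_sumr -sum_neighbours big_split /= sum_cliques_at -mulr_sumr.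
rewrite [walk_prob e K eps k.+1 u v]walk_probS.
by field; rewrite D_neq0.
Qed.

Lemma walk_prob1 u v : walk_prob e K eps 1 u v = (e u v)%:R / D.
Proof.
rewrite walk_probS -sum_neighbours mulrC; congr (_ / _).
case: (boolP (e u v)) => euv.
  rewrite (bigD1 v)//= eqxx big1 ?addr0// => i /andP[_]; by case: eqP.
by rewrite big1// => i eui; case: eqP eui euv => // -> ->.
Qed.

End CliqueWalk.

(** * Spectrum of the adjacency matrix *)

Section SymmetricDiagonalization.
Variable R : realType.

Lemma trmx_horner n (A : 'M[R]_n.+1) (p : {poly R}) : A^T = A ->
  (horner_mx A p)^T = horner_mx A p.
Proof.
move=> sA; elim/poly_ind: p => [|p c IH]; first by rewrite !rmorph0 trmx0.
rewrite rmorphD rmorphM /= horner_mx_X horner_mx_C linearD /= tr_scalar_mx.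
congr (_ + _); rewrite -!mulmxE trmx_mul IH sA.
exact: comm_mx_horner.
Qed.

(** The diagonal entries of [N N^T] are sums of squares of the entries in the rows of [N]. *)
Lemma sym_mx_sqr_eq0 n (N : 'M[R]_n) : N^T = N -> N *m N = 0 -> N = 0.
Proof.
move=> sN N2; apply/matrixP => i j; rewrite mxE.
have /matrixP/(_ i i) := N2; rewrite !mxE => /eqP.
rewrite psumr_eq0 => [|k _]; last by rewrite -{2}sN mxE -expr2 sqr_ge0.
by move=> /allP/(_ j); rewrite mem_index_enum => /(_ isT); rewrite -{2}sN mxE mulf_eq0 orbb => /eqP.
Qed.

Lemma sym_mx_nilpotent n (N : 'M[R]_n.+1) m : N^T = N -> N ^+ m = 0 -> N = 0.
Proof.
move=> sN; have sX k : (N ^+ k)^T = N ^+ k.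
  have := @trmx_horner _ N 'X^k sN.
  by rewrite rmorphXn /= horner_mx_X.
elim: m => [|[|m] IH]; rewrite ?expr1//.
  by move=> /(congr1 (fun M => N *m M)); rewrite expr0 mulmx1 mulmx0.
(* The exponent drops by one: the square of [N^(m+1)] is [N^m N^(m+2) = 0]. *)
move=> h; apply: IH; apply: sym_mx_sqr_eq0 => //.
by rewrite mulmxE -exprD addSnnS exprD h mulr0.
Qed.

Lemma char_poly_conj n (P A B : 'M[R]_n) : P \in unitmx -> P *m A = B *m P ->
  char_poly A = char_poly B.
Proof.
move=> Pu PA; rewrite /char_poly.
have Pu' : \det (map_mx (@polyC R) P) != 0.
  by rewrite det_map_mx polyC_eq0 -unitfE -unitmxE.
apply: (mulfI Pu'); rewrite -det_mulmx [RHS]mulrC -det_mulmx.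
congr (\det _); rewrite /char_poly_mx mulmxBr mulmxBl -!map_mxM PA.
by rewrite scalar_mxC.
Qed.

(* An eigenvalue factor to the first power already annihilates a symmetric
   matrix: by Cayley-Hamilton the product of the distinct factors is nilpotent,
   and a nilpotent symmetric matrix vanishes. *)
Lemma sym_mx_diagonalization n (A : 'M[R]_n) (lam : seq R) : A^T = A ->
    char_poly A = \prod_(x <- lam) ('X - x%:P) ->
  exists (P : 'M[R]_n) (mu : 'I_n -> R), [/\ P \in unitmx,
    P *m A = diag_mx (\row_i mu i) *m P &
    perm_eq [seq mu i | i <- enum 'I_n] lam].
Proof.
move=> sA cA.
(* Once [A] is diagonalized, the multiset of diagonal entries can be read off the characteristic
   polynomial. *)
suff [P [mu [Pu PA]]] : exists (P : 'M[R]_n) (mu : 'I_n -> R),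
    P \in unitmx /\ P *m A = diag_mx (\row_i mu i) *m P.
  exists P, mu; split=> //; apply: prod_XsubC_eq; rewrite -cA.
  rewrite (char_poly_conj Pu PA) char_poly_trig ?diag_mx_is_trig// big_map big_enum /=.
  by apply: eq_bigr => i _; rewrite !mxE eqxx.
case: n => [|n] in A sA cA *.
  by exists 1%:M, (fun=> 0); rewrite unitmx1; split=> //; apply/matrixP => -[].
have : diagonalizable A.
  apply/mxpoly.diagonalizableP; exists (undup lam); first exact: undup_uniq.
  apply: mxminpoly_min; set q := \prod_(x <- _) _.
  apply: (@sym_mx_nilpotent _ _ (size lam)); first exact: trmx_horner.
  have : char_poly A %| q ^+ size lam.
    rewrite cA; have qlam x : x \in lam -> root q x.
      by rewrite root_prod_XsubC mem_undup.
    elim: {cA}(lam) qlam => [|x s IH] qlam; first by rewrite big_nil dvd1p.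
    rewrite big_cons exprS dvdp_mul//; last by apply: IH => y ys; rewrite qlam// inE ys orbT.
    by rewrite dvdp_XsubCl qlam// mem_head.
  case/dvdpP => r /(congr1 (horner_mx A)).
  by rewrite rmorphXn rmorphM /= Cayley_Hamilton mulr0.
case=> P Pu /mxpoly.diagonalizable_forPex[D /(mxpoly.simmxP Pu) PA].
exists P, (D 0); split=> //; rewrite PA; congr (diag_mx _ *m P).
by apply/rowP => i; rewrite mxE.
Qed.

End SymmetricDiagonalization.

(** * Dual bases of eigenfunctions *)

Section GraphSpectrum.
Variables (R : realType) (T : finType) (e : rel T).
Hypothesis hG : simple_graph e.

Lemma sum_enum_rank (V : nmodType) (F : 'I_#|T| -> V) :
  \sum_j F j = \sum_(x : T) F (enum_rank x).
Proof. by rewrite (reindex (@enum_rank T)) //; exact/onW_bij/enum_rank_bij. Qed.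

(** [f] collects the rows of the diagonalizing matrix [P] and [g] the columns of its inverse; both
    are eigenfunctions because the matrix is symmetric. As [P] is only known to be invertible,
    orthonormality becomes the two duality relations [P P^-1 = 1] and [P^-1 P = 1]. *)
Lemma adjacency_diagonalization (lam : seq R) :
    is_spectrum (adjacency_matrix R e) lam ->
  exists (mu : 'I_#|T| -> R) (f g : 'I_#|T| -> T -> R),
    [/\ perm_eq [seq mu i | i <- enum 'I_#|T|] lam,
        (forall i x, \sum_(y | e x y) f i y = mu i * f i x),
        (forall i x, \sum_(y | e x y) g i y = mu i * g i x),
        (forall i j, \sum_x f i x * g j x = (i == j)%:R) &
        (forall x y, \sum_i g i x * f i y = (x == y)%:R)].
Proof.
set A := adjacency_matrix R e => -[_ cA].
have AE x y : A (enum_rank x) (enum_rank y) = (e x y)%:R.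
  by rewrite mxE !enum_rankK.
have sA : A^T = A by apply/matrixP => i j; rewrite !mxE (hG.1 (enum_val i)).
have [P [mu [Pu PA pm]]] := sym_mx_diagonalization sA cA.
exists mu, (fun i x => P i (enum_rank x)), (fun i x => invmx P (enum_rank x) i).
split=> // [i x|i x|i j|x y].
- have /matrixP/(_ i (enum_rank x)) := PA; rewrite mxE sum_enum_rank => h.
  rewrite big_mkcond (eq_bigr (fun y => P i (enum_rank y) * A (enum_rank y) (enum_rank x))).
    by rewrite h mul_diag_mx !mxE.
  by move=> y _; rewrite AE (hG.1 y); case: (e x y); rewrite ?mulr1 ?mulr0.
- have AQ : A *m invmx P = invmx P *m diag_mx (\row_i mu i).
    by rewrite -[A](mulKmx Pu) PA !mulmxA mulmxK.
  have /matrixP/(_ (enum_rank x) i) := AQ; rewrite mxE sum_enum_rank => h.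
  rewrite big_mkcond (eq_bigr (fun y => A (enum_rank x) (enum_rank y) * invmx P (enum_rank y) i)).
    by rewrite h mul_mx_diag !mxE mulrC.
  by move=> y _; rewrite AE; case: (e x y); rewrite ?mul1r ?mul0r.
- by have /matrixP/(_ i j) := mulmxV Pu; rewrite !mxE sum_enum_rank.
- by have /matrixP/(_ (enum_rank x) (enum_rank y)) := mulVmx Pu; rewrite !mxE (inj_eq enum_rank_inj).
Qed.

End GraphSpectrum.

(** * Eigenvalue bounds and their extremal eigenfunctions *)

Section GraphEigenfunctions.
Variables (R : realType) (T : finType) (e : rel T) (K : {set {set T}}).
Variables (d l : nat).
Hypotheses (hd : (2 <= d)%N) (hl : (2 <= l)%N).
Hypotheses (hG : simple_graph e) (hconn : connected_graph e).
Hypothesis (hK : clique_partition e d l K).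
Let D : R := d%:R * (l%:R - 1).

Lemma connected_const (V : Type) (h : T -> V) :
  (forall x y, e x y -> h x = h y) -> forall x y, h x = h y.
Proof.
move=> he x y; have /connectP[p pth ->] := hconn x y.
by elim: p x pth => //= z p IH x /andP[/he -> /IH].
Qed.

Lemma sum_degree (x : T) : \sum_(y | e x y) (1 : R) = D.
Proof.
have -> : \sum_(y | e x y) (1 : R) = \sum_(y in neighbours e x) 1.
  by apply: eq_bigl => y; rewrite inE.
rewrite sumr_const (card_neighbours hG hK) natrM /D -subn1 natrB//.
exact: ltnW.
Qed.

Section Eigenfunction.
Variables (mu : R) (f : T -> R) (x0 : T).
Hypothesis hf : forall x, \sum_(y | e x y) f y = mu * f x.
Hypothesis hx0 : f x0 != 0.

Let N2 : R := \sum_x f x ^+ 2.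

Let N2_gt0 : 0 < N2.
Proof.
rewrite /N2 (bigD1 x0)//= ltr_wpDr ?sumr_ge0// => [x _|]; first exact: sqr_ge0.
by rewrite lt_neqAle sqr_ge0 andbT eq_sym sqrf_eq0.
Qed.

(** A Dirichlet form for [c = 1], its signless version for [c = -1]. Its nonnegativity bounds [mu],
    and its vanishing forces [f x = c * f y] along edges. *)
Let energy (c : R) : \sum_x \sum_(y | e x y) (f x - c * f y) ^+ 2 =
  (D * (1 + c ^+ 2) - 2 * c * mu) * N2.
Proof.
have -> : \sum_x \sum_(y | e x y) (f x - c * f y) ^+ 2 =
    \sum_x (\sum_(y | e x y) 1) * f x ^+ 2 +
    c ^+ 2 * \sum_x (\sum_(y | e x y) f y ^+ 2) -
    2 * c * \sum_x (f x * \sum_(y | e x y) f y).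
  rewrite !mulr_sumr -big_split -sumrB; apply: eq_bigr => x _ /=.
  rewrite !mulr_sumr mulr_suml -big_split -sumrB; apply: eq_bigr => y _ /=; ring.
have -> : \sum_x (\sum_(y | e x y) f y ^+ 2) = D * N2.
  rewrite (exchange_big_dep xpredT)//= /N2 mulr_sumr; apply: eq_bigr => y _.
  rewrite -(sum_degree y) mulr_suml; apply: eq_big => [x|x _]; first by rewrite (hG.1 x).
  by rewrite mul1r.
under eq_bigr do rewrite sum_degree.
under [X in _ - _ * X]eq_bigr do rewrite hf.
have -> : \sum_x (f x * (mu * f x)) = mu * N2.
  by rewrite /N2 mulr_sumr; apply: eq_bigr => x _; ring.
rewrite -mulr_sumr -/N2; ring.
Qed.

Lemma eigenvalue_le_degree : mu <= D.
Proof.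
have : 0 <= \sum_x \sum_(y | e x y) (f x - 1 * f y) ^+ 2.
  by apply: sumr_ge0 => x _; apply: sumr_ge0 => y _; exact: sqr_ge0.
by rewrite energy pmulr_lge0// => h; lra.
Qed.

Let energy0 c : (D * (1 + c ^+ 2) - 2 * c * mu) = 0 ->
  forall x y, e x y -> f x = c * f y.
Proof.
move=> h x y exy; have := energy c; rewrite h mul0r => /eqP.
rewrite psumr_eq0 => [/allP/(_ x)|z _]; last by apply: sumr_ge0 => w _; exact: sqr_ge0.
rewrite mem_index_enum => /(_ isT) /=; rewrite psumr_eq0 => [/allP/(_ y)|w _]; last exact: sqr_ge0.
by rewrite mem_index_enum => /(_ isT) /implyP/(_ exy); rewrite sqrf_eq0 subr_eq0 => /eqP.
Qed.

Lemma eigenfunction_top : mu = D -> forall x y, f x = f y.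
Proof.
move=> muD; apply: connected_const => x y exy; rewrite -[f y]mul1r.
by apply: energy0 exy; rewrite muD; ring.
Qed.

(** The energy at [c = -1] vanishes, so [f] changes sign along every edge; [|f|] is then a nonzero
    constant by connectedness, and the sign of [f] is a proper 2-colouring. *)
Lemma eigenvalue_opp_degree : mu = - D -> bipartite_graph e.
Proof.
move=> muD; have fe x y : e x y -> f x = - f y.
  by move=> exy; rewrite -[RHS]mulN1r; apply: energy0 exy; rewrite muD; ring.
have fn x : f x != 0.
  rewrite -normr_eq0 (@connected_const _ (fun x => `|f x|) _ x x0) ?normr_eq0//.
  by move=> y z /fe ->; rewrite normrN.
exists (fun x => 0 < f x) => x y /fe ->; rewrite oppr_gt0.
by have := fn y; case: ltgtP.
Qed.

(* With N the vertex-clique incidence matrix, the adjacency matrix is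
   N N^T - d, and N N^T is positive semidefinite. *)
Lemma eigenvalue_ge_Nd : - d%:R <= mu.
Proof.
suff : 0 <= (mu + d%:R) * N2 by rewrite pmulr_lge0//; lra.
suff -> : (mu + d%:R) * N2 = \sum_(C in K) (\sum_(x in C) f x) ^+ 2.
  by apply: sumr_ge0 => C _; exact: sqr_ge0.
have -> : (mu + d%:R) * N2 =
    \sum_x \sum_(C in K | x \in C) f x * (\sum_(y in C) f y).
  rewrite /N2 mulr_sumr; apply: eq_bigr => x _.
  have -> : (mu + d%:R) * f x ^+ 2 = f x * (mu * f x) + f x ^+ 2 * d%:R by ring.
  rewrite -hf (sum_neighbours hG hK) mulr_natr -(sum_cliques_const hK _ x) mulr_sumr -big_split.
  apply: eq_bigr => C /andP[CK xC] /=.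
  by rewrite [in RHS](bigD1 x)//= mulrDr addrC expr2.
rewrite (exchange_big_dep (mem K))/= => [|x C _ /andP[]//].
apply: eq_bigr => C CK; rewrite -mulr_suml expr2; congr (_ * _).
by apply: eq_bigl => x; rewrite CK.
Qed.

End Eigenfunction.
End GraphEigenfunctions.

(** * Modes of the walk *)

Section Modes.
Variable R : realType.
Implicit Types (t s m : R).

Fixpoint mode t s m k : R :=
  if k is k1.+1 then
    if k1 is k2.+1 then t * mode t s m k1 - s * mode t s m k2 else m
  else 1.

Lemma modeSS t s m k : mode t s m k.+2 = t * mode t s m k.+1 - s * mode t s m k.
Proof. by []. Qed.

Lemma two_step_ind (P : nat -> Prop) :
  P 0%N -> P 1%N -> (forall k, P k -> P k.+1 -> P k.+2) -> forall k, P k.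
Proof.
move=> P0 P1 PSS k; suff : P k /\ P k.+1 by case.
by elim: k => // k [? ?]; split=> //; exact: PSS.
Qed.

Lemma mode_expr t s x : x ^+ 2 = t * x - s -> forall k, mode t s x k = x ^+ k.
Proof.
move=> xE; elim/two_step_ind => // k IH1 IH2; rewrite modeSS IH1 IH2.
by rewrite -addn2 exprD xE exprS; ring.
Qed.

(** The Schur-Jury stability criterion: for real roots, squaring [sqrt (t^2 - 4 s) < 2 - |t|] turns
    it into [|t| < 1 + s]. *)
Lemma root_radius_lt1 t s : 0 <= s -> s < 1 -> `|t| < 1 + s -> root_radius t s < 1.
Proof.
move=> s0 s1 ts; case: (leP (t ^+ 2) (4 * s)) => h.
  by rewrite root_radius_nonreal// -[ltRHS]sqrtr1 ltr_sqrt.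
rewrite root_radius_real ?(ltW h)//.
suff : Num.sqrt (t ^+ 2 - 4 * s) < 2 - `|t| by lra.
have t2 : 0 <= 2 - `|t| by lra.
rewrite -ltr_sqr ?nnegrE ?sqrtr_ge0// sqr_sqrtr ?subr_ge0 ?(ltW h)//.
rewrite -(real_normK (num_real t)) sqrrB; lra.
Qed.

Lemma growth_rate_cvg0 (p : nat -> R) r : 0 <= r -> r < 1 -> growth_rate p r ->
  p k @[k --> \oo] --> (0 : R).
Proof.
move=> r0 r1 [up _]; set r' := (r + 1) / 2.
have rr' : r < r' by rewrite /r'; lra.
have r'1 : r' < 1 by rewrite /r'; lra.
have [C hC] := up _ rr'.
have h : C * r' ^+ k @[k --> \oo] --> (0 : R).
  rewrite -(mulr0 C); apply: cvgMl_tmp; apply: cvg_expr.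
  by rewrite ger0_norm// (le_trans r0)// ltW.
apply/cvgr0Pnorm_le => y y0; have /cvgr0Pnorm_le/(_ _ y0) := h.
apply: filterS => k; apply: le_trans; apply: le_trans (hC k) _; exact: ler_norm.
Qed.

(** [root_radius] is a single expression in maxima and square roots, so continuity survives the
    passage from real to non-real roots. *)
Lemma root_radius_continuous (t s : R -> R) :
  continuous t -> continuous s -> continuous (fun x => root_radius (t x) (s x)).
Proof.
move=> ct cs x; rewrite /root_radius; apply: cvgMr_tmp; apply: cvgD.
  apply: (@continuous_max R R (fun y => `|t y|) (fun y => 2 * Num.sqrt (s y)) x).
    exact: cvg_norm (ct x).
  apply: cvgMl_tmp; apply: (@continuous_comp _ _ _ s (@Num.sqrt R) x (cs x)).
  exact: sqrt_continuous.
apply: (@continuous_comp _ _ _ (fun y => t y ^+ 2 - 4 * s y) (@Num.sqrt R) x).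
  by apply: cvgB; [apply: cvgM (ct x) (ct x) | exact: cvgMl_tmp (cs x)].
exact: sqrt_continuous.
Qed.

End Modes.

(** * The scalar recurrence attached to one adjacency eigenvalue *)

Section WalkModes.
Variables (R : realType) (d l : nat).
Hypotheses (hd : (2 <= d)%N) (hl : (2 <= l)%N).
Let D : R := d%:R * (l%:R - 1).
Implicit Types (eps mu : R).

Definition turn_det eps : R := (1 - d%:R * eps) / ((d%:R - 1) * (l%:R - 1)).

Definition turn_trace eps mu : R :=
  (1 - eps) / ((d%:R - 1) * (l%:R - 1)) * mu - (l%:R - 2) * turn_det eps.

(* On the eigenspace of [- d] the initial condition selects the root
   [- 1 / (l - 1)] alone, whichever root is larger. *)
Definition walk_rate eps mu : R :=
  if mu == - d%:R then (l%:R - 1)^-1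
  else root_radius (turn_trace eps mu) (turn_det eps).

Definition walk_mode eps mu := mode (turn_trace eps mu) (turn_det eps) (mu / D).

Let l2 : 2 <= l%:R :> R. Proof. by rewrite ler_nat. Qed.
Let d2 : 2 <= d%:R :> R. Proof. by rewrite ler_nat. Qed.
Let l1_gt0 : 0 < l%:R - 1 :> R. Proof. by move: l2; lra. Qed.
Let d1_gt0 : 0 < d%:R - 1 :> R. Proof. by move: d2; lra. Qed.
Let d_gt0 : 0 < d%:R :> R. Proof. by move: d2; lra. Qed.
Let neqs : [/\ l%:R - 1 != 0 :> R, d%:R - 1 != 0 :> R & d%:R != 0 :> R].
Proof. by rewrite !gt_eqF. Qed.

Let deps_le1 eps : (d%:R * eps <= 1) = (eps <= d%:R^-1).
Proof. by rewrite -ler_pdivlMl// mulr1. Qed.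

Let deps_lt1 eps : (d%:R * eps < 1) = (eps < d%:R^-1).
Proof. by rewrite -ltr_pdivlMl// mulr1. Qed.

Lemma walk_mode_top eps k : walk_mode eps D k = 1.
Proof.
case: neqs => n1 n2 n3.
rewrite /walk_mode divff ?mulf_neq0// mode_expr ?expr1n//.
rewrite /turn_trace /turn_det /D; field; by rewrite ?n1 ?n2.
Qed.

Lemma walk_mode_bottom eps k : walk_mode eps (- d%:R) k = (- (l%:R - 1)^-1) ^+ k.
Proof.
case: neqs => n1 n2 n3.
have e : - d%:R / D = - (l%:R - 1)^-1 by rewrite /D; field; rewrite n1 n3.
rewrite /walk_mode e mode_expr//.
rewrite /turn_trace /turn_det /D; field; by rewrite ?n1 ?n2.
Qed.

(** The left side is the nondegeneracy quantity of [growth_rate_rec] for [p 0 = 1], [p 1 = mu / D];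
    for [eps] below [1 / d] it vanishes only at [mu = D] and [mu = - d]. *)
Lemma walk_mode_charpoly eps mu :
  (mu / D) ^+ 2 - turn_trace eps mu * (mu / D) + turn_det eps
  = - (1 - d%:R * eps) / ((d%:R - 1) * D ^+ 2) * ((mu - D) * (mu + d%:R)).
Proof.
case: neqs => n1 n2 n3.
rewrite /turn_trace /turn_det /D; field; by rewrite n1 n2 n3.
Qed.

Lemma turn_det_ge0 eps : eps <= d%:R^-1 -> 0 <= turn_det eps.
Proof.
move=> h; rewrite divr_ge0 ?mulr_ge0 ?(ltW l1_gt0) ?(ltW d1_gt0)// subr_ge0.
by rewrite deps_le1.
Qed.

Lemma turn_det_gt0 eps : eps < d%:R^-1 -> 0 < turn_det eps.
Proof.
move=> h; rewrite divr_gt0 ?mulr_gt0// subr_gt0.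
by rewrite deps_lt1.
Qed.

Lemma walk_rate_ge0 eps mu : 0 <= walk_rate eps mu.
Proof.
by rewrite /walk_rate; case: ifP => _; rewrite ?root_radius_ge0// invr_ge0 ltW.
Qed.

Lemma growth_rate_walk_mode eps mu : eps <= d%:R^-1 -> mu != D ->
  growth_rate (walk_mode eps mu) (walk_rate eps mu).
Proof.
case: neqs => n1 n2 n3 heps muD; rewrite /walk_rate; case: eqVneq => [->|mud].
  have -> : (l%:R - 1)^-1 = `|- (l%:R - 1)^-1| :> R.
    by rewrite normrN gtr0_norm ?invr_gt0.
  have -> : walk_mode eps (- d%:R) = fun k => (- (l%:R - 1)^-1) ^+ k.
    by apply/funext => k; rewrite walk_mode_bottom.
  exact: growth_rate_expr.
(* At [eps = 1 / d] the walk is the simple random walk: the constant term of the characteristic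
   polynomial vanishes and the modes are powers of [mu / D]. *)
have [e|ne] := eqVneq eps d%:R^-1.
  have det0 : turn_det eps = 0 by rewrite /turn_det e divff// subrr mul0r.
  have tr : turn_trace eps mu = mu / D.
    rewrite /turn_trace det0 e /D; field; by rewrite n1 n2 n3.
  rewrite root_radius_real det0 ?mulr0 ?sqr_ge0// subr0 sqrtr_sqr tr.
  have -> : walk_mode eps mu = fun k => (mu / D) ^+ k.
    by apply/funext => k; rewrite /walk_mode mode_expr// tr det0 subr0 expr2.
  have -> : (`|mu / D| + `|mu / D|) / 2 = `|mu / D| by field.
  exact: growth_rate_expr.
have h : eps < d%:R^-1 by rewrite lt_neqAle ne.
apply: growth_rate_rec; first exact: turn_det_gt0.
  by move=> k; rewrite /walk_mode modeSS.
rewrite /walk_mode /= mulr1 expr1n mulr1 walk_mode_charpoly.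
rewrite !mulf_neq0 ?invr_neq0 ?mulf_neq0 ?oppr_eq0 ?expf_neq0 ?mulf_neq0//.
- have : 0 < 1 - d%:R * eps; last by move/gt_eqF=> ->.
  by rewrite subr_gt0 deps_lt1.
- by rewrite subr_eq0.
- by rewrite addr_eq0.
Qed.

(** The trace increases with [mu], equals [1 + s] at [mu = D] and is at least [- (1 + s)] at
    [mu = - d], so strictly between them the stability criterion applies. Its condition [s < 1]
    comes from [d - 1] or [l - 1] being at least 2. *)
Lemma walk_rate_lt1 eps mu : 0 <= eps -> eps <= d%:R^-1 ->
    (3 <= d)%N || (3 <= l)%N -> - d%:R <= mu -> mu < D -> mu != - D ->
  walk_rate eps mu < 1.
Proof.
case: neqs => n1 n2 n3 e0 e1 dl mud muD muND; rewrite /walk_rate; case: eqVneq => [mE|mE].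
  rewrite invf_lt1//; suff : (2 < l)%N by rewrite -(ltr_nat R); lra.
  (* For [l = 2] the eigenvalue [- d] coincides with the excluded [- D]. *)
  rewrite ltn_neqAle hl andbT; apply: contraNneq muND => l2E.
  by rewrite mE /D -l2E; apply/eqP; ring.
have de0 : 0 <= 1 - d%:R * eps.
  by rewrite subr_ge0 deps_le1.
have de1 : 1 - d%:R * eps <= 1 by rewrite gerBl mulr_ge0// (ltW d_gt0).
have s0 := turn_det_ge0 e1.
have sE : turn_det eps * (l%:R - 1) = (1 - d%:R * eps) / (d%:R - 1).
  by rewrite /turn_det; field; rewrite n1 n2.
apply: root_radius_lt1 => //.
  rewrite /turn_det ltr_pdivrMr ?mulr_gt0// mul1r; apply: le_lt_trans de1 _.
  case/orP: dl; rewrite -(ler_nat R) => h3.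
    apply: (@lt_le_trans _ _ (2 * 1)); first lra.
    by apply: ler_pM => //; move: l2 h3; lra.
  apply: (@lt_le_trans _ _ (1 * 2)); first lra.
  by apply: ler_pM => //; move: d2 h3; lra.
have b0 : 0 < (1 - eps) / ((d%:R - 1) * (l%:R - 1)).
  rewrite divr_gt0 ?mulr_gt0// subr_gt0 (le_lt_trans e1)// invf_lt1//.
  by move: d2; lra.
have tD : turn_trace eps D = 1 + turn_det eps.
  rewrite /turn_trace /turn_det /D; field; by rewrite n1 n2.
(* The value at [-1] of the characteristic polynomial for [mu = - d], whose roots are
   [- 1 / (l - 1)] and [- s (l - 1)]. *)
have td : turn_trace eps (- d%:R) + (1 + turn_det eps) =
    (1 - (l%:R - 1)^-1) * (1 - turn_det eps * (l%:R - 1)).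
  rewrite /turn_trace /turn_det; field; by rewrite n1 n2.
have td0 : 0 <= turn_trace eps (- d%:R) + (1 + turn_det eps).
  rewrite td mulr_ge0// subr_ge0.
    by rewrite invf_le1//; move: l2; lra.
  by rewrite sE ler_pdivrMr// mul1r (le_trans de1)//; move: d2; lra.
have mono x y : x < y -> turn_trace eps x < turn_trace eps y.
  by move=> xy; rewrite /turn_trace ltrD2r ltr_pM2l.
rewrite ltr_norml -tD mono// andbT.
have := mono (- d%:R) mu; rewrite lt_neqAle eq_sym mE mud => /(_ isT).
rewrite tD; lra.
Qed.

Lemma walk_rate_continuous mu : continuous (walk_rate ^~ mu).
Proof.
have -> : walk_rate ^~ mu = if mu == - d%:R then fun=> (l%:R - 1)^-1
    else fun eps => root_radius (turn_trace eps mu) (turn_det eps).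
  by apply/funext => eps; rewrite /walk_rate; case: ifP.
case: ifP => _; first by move=> x; apply: cvg_cst.
have cs : continuous turn_det.
  move=> x; apply: cvgMr_tmp; apply: cvgB; first exact: cvg_cst.
  by apply: cvgMl_tmp; apply: cvg_id.
apply: root_radius_continuous => // x; apply: cvgB.
  apply: cvgMr_tmp; apply: cvgMr_tmp; apply: cvgB; first exact: cvg_cst.
  exact: cvg_id.
exact: cvgMl_tmp (cs x).
Qed.

End WalkModes.

(** * The mixing rate *)

Section MixingRate.
Variables (R : realType) (T : finType) (e : rel T) (K : {set {set T}}).
Variables (d l : nat).
Hypotheses (hd : (2 <= d)%N) (hl : (2 <= l)%N).
Hypotheses (hG : simple_graph e) (hconn : connected_graph e).
Hypothesis (hK : clique_partition e d l K).
Let D : R := d%:R * (l%:R - 1).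
Local Notation n := #|T|.

Variables (mu : 'I_n -> R) (f g : 'I_n -> T -> R).
Hypothesis hf : forall i x, \sum_(y | e x y) f i y = mu i * f i x.
Hypothesis hg : forall i x, \sum_(y | e x y) g i y = mu i * g i x.
Hypothesis hfg : forall i j, \sum_x f i x * g j x = (i == j)%:R.
Hypothesis hgf : forall x y, \sum_i g i x * f i y = (x == y)%:R.

Let l1_neq0 : l%:R - 1 != 0 :> R.
Proof. by rewrite subr_eq0 pnatr_eq1 gtn_eqF. Qed.

Let d1_neq0 : d%:R - 1 != 0 :> R.
Proof. by rewrite subr_eq0 pnatr_eq1 gtn_eqF. Qed.

Let d_neq0 : d%:R != 0 :> R.
Proof. by rewrite pnatr_eq0 -lt0n ltnW. Qed.

Let D_neq0 : D != 0. Proof. by rewrite mulf_neq0. Qed.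

Let degE x : \sum_(y | e x y) (1 : R) = D.
Proof. exact: sum_degree hl hG hK x. Qed.

(** Both sides obey the same two-step recurrence, because the adjacency operator multiplies [g i] by
    [mu i]. *)
Lemma walk_prob_modes eps k u v : walk_prob e K eps k u v =
  \sum_i g i u * walk_mode d l eps (mu i) k * f i v.
Proof.
elim/two_step_ind: k u v => [u v|u v|k IH0 IH1 u v].
- rewrite walk_prob0 -hgf; apply: eq_bigr => i _.
  by rewrite /walk_mode /= mulr1.
- rewrite (walk_prob1 hd hl hG hK).
  have -> : (e u v)%:R = \sum_(y | e u y) (y == v)%:R :> R.
    case: (boolP (e u v)) => euv.
      by rewrite (bigD1 v)//= eqxx big1 ?addr0// => y /andP[_ /negPf ->].
    by rewrite big1// => y euy; case: eqP euy euv => // -> ->.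
  under eq_bigr do rewrite -hgf.
  rewrite exchange_big mulr_suml; apply: eq_bigr => i _ /=.
  by rewrite -mulr_suml hg /walk_mode /= -/D; field.
rewrite (walk_prob_rec hd hl hG hK) IH0 IH1.
under eq_bigr do rewrite IH1.
rewrite exchange_big /= !mulr_sumr -!big_split; apply: eq_bigr => i _ /=.
rewrite -!mulr_suml hg /walk_mode modeSS -!/(walk_mode _ _ _ _ _) /turn_trace /turn_det.
set m1 := walk_mode _ _ _ _ _; set m0 := walk_mode _ _ _ _ _.
by field; rewrite l1_neq0 d1_neq0.
Qed.

Lemma eigenbasis_neq0 i : (exists x, f i x != 0) /\ (exists x, g i x != 0).
Proof.
have := hfg i i; rewrite eqxx => h; split; apply/existsP; apply: contraT;
  move=> /existsPn z; move: h; rewrite big1 => [/esym/eqP|x _]; rewrite ?oner_eq0//.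
  by have := z x; rewrite negbK => /eqP ->; rewrite mul0r.
by have := z x; rewrite negbK => /eqP ->; rewrite mulr0.
Qed.

(** With [c i] the pairing of [g i] with the constant function 1, symmetry gives
    [mu i * c i = D * c i]; expanding that constant in the [f i] shows that some [c i] is
    nonzero. *)
Lemma exists_top (x0 : T) : exists i0, mu i0 = D.
Proof.
pose c i : R := \sum_x g i x.
have cE i : mu i * c i = D * c i.
  rewrite /c !mulr_sumr; under eq_bigr do rewrite -hg.
  rewrite (exchange_big_dep xpredT)//=; apply: eq_bigr => y _.
  rewrite -(degE y) mulr_suml.
  by apply: eq_big => [x|x _]; rewrite ?mul1r// (hG.1 x).
have [i ci] : exists i, c i != 0.
  apply/existsP; apply: contraT => /existsPn z.
  have : \sum_i c i * f i x0 = 1.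
    under eq_bigr do rewrite mulr_suml.
    rewrite exchange_big /=; under eq_bigr do rewrite hgf.
    by rewrite (bigD1 x0)//= eqxx big1 ?addr0// => y /negPf ->.
  rewrite big1 => [/esym/eqP|i _]; rewrite ?oner_eq0//.
  by have := z i; rewrite negbK => /eqP ->; rewrite mul0r.
by exists i; exact: mulIf ci _ _ (cE i).
Qed.

Lemma top_const i : mu i = D -> forall x y, f i x = f i y /\ g i x = g i y.
Proof.
by move=> iD x y; split; apply: (eigenfunction_top hl hG hconn hK _ iD).
Qed.

(** Eigenfunctions for [D] are constant, so [f i] and [f j] would be proportional, against their
    duality with the [g]. *)
Lemma top_unique i j : mu i = D -> mu j = D -> i = j.
Proof.
move=> /top_const fi /top_const fj; apply/eqP; apply: contraT => ij.
have [[x0 _] _] := eigenbasis_neq0 i.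
have si k : \sum_x f i x * g k x = f i x0 * \sum_x g k x.
  by rewrite mulr_sumr; apply: eq_bigr => x _; rewrite (fi x x0).1.
have sj : \sum_x f j x * g j x = f j x0 * \sum_x g j x.
  by rewrite mulr_sumr; apply: eq_bigr => x _; rewrite (fj x x0).1.
have := hfg j j; rewrite sj eqxx; have := hfg i j; rewrite si (negPf ij) => /eqP.
rewrite mulf_eq0 => /orP[/eqP fi0|/eqP -> /esym/eqP]; last by rewrite mulr0 oner_eq0.
by have := hfg i i; rewrite si fi0 mul0r eqxx => /esym/eqP; rewrite oner_eq0.
Qed.

Lemma top_projection i u v : mu i = D -> g i u * f i v = n%:R^-1.
Proof.
move=> /top_const fi; have := hfg i i; rewrite eqxx.
rewrite (eq_bigr (fun=> g i u * f i v)) => [|x _]; last first.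
  by rewrite (fi x v).1 (fi x u).2 mulrC.
rewrite sumr_const -[_ *+ #|_|]mulr_natl => h.
have n0 : n%:R != 0 :> R.
  by apply: contra_eq_neq h => ->; rewrite mul0r eq_sym oner_neq0.
by apply: (mulfI n0); rewrite h divff.
Qed.

(* Otherwise (A - D)(A + d) = 0, whose diagonal entries are D - D d. *)
Lemma exists_not_bottom (x0 : T) : exists2 i, mu i != D & mu i != - d%:R.
Proof.
suff : [exists i, (mu i != D) && (mu i != - d%:R)] by case/existsP=> i /andP[]; exists i.
apply: contraT => /existsPn z.
(* [h0], [h1] and [h2] compute the entries at [(x0, x0)] of the identity, of [A] (no loops) and of
   [A^2] (the degree). *)
have h0 : \sum_i g i x0 * f i x0 = 1 by rewrite hgf eqxx.
have h1 : \sum_i g i x0 * mu i * f i x0 = 0.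
  under eq_bigr do rewrite (mulrC _ (mu _)) -hg mulr_suml.
  rewrite exchange_big /= big1// => y ey; rewrite hgf; case: eqP ey => // ->.
  by rewrite (hG.2 x0).
have h2 : \sum_i g i x0 * mu i ^+ 2 * f i x0 = D.
  have -> : \sum_i g i x0 * mu i ^+ 2 * f i x0 =
      \sum_i (\sum_(y | e x0 y) g i y) * (\sum_(z | e x0 z) f i z).
    by apply: eq_bigr => i _; rewrite hg hf; ring.
  under eq_bigr do rewrite mulr_suml.
  rewrite exchange_big -(degE x0) /=; apply: eq_bigr => y ey.
  under eq_bigr do rewrite mulr_sumr.
  rewrite exchange_big /=; under eq_bigr do rewrite hgf.
  by rewrite (bigD1 y)//= eqxx big1 ?addr0// => w /andP[_]; rewrite eq_sym => /negPf ->.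
have : \sum_i (g i x0 * mu i ^+ 2 * f i x0 + (d%:R - D) * (g i x0 * mu i * f i x0)
     - d%:R * D * (g i x0 * f i x0)) = 0.
  apply: big1 => i _.
  have -> : g i x0 * mu i ^+ 2 * f i x0 + (d%:R - D) * (g i x0 * mu i * f i x0)
     - d%:R * D * (g i x0 * f i x0) = g i x0 * f i x0 * ((mu i - D) * (mu i + d%:R)) by ring.
  have := z i; rewrite negb_and !negbK => /orP[]/eqP ->; ring.
rewrite sumrB big_split /= -!mulr_sumr h0 h1 h2 => h.
have : D * (1 - d%:R) = 0 by rewrite -h; ring.
by move/eqP; rewrite mulf_eq0 (negPf D_neq0) -opprB oppr_eq0 (negPf d1_neq0).
Qed.

Variable i0 : 'I_n.
Hypothesis hi0 : mu i0 = D.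

Let not_top i : i != i0 -> mu i != D.
Proof. by apply: contra_neq => h; exact: top_unique. Qed.

Lemma walk_prob_sub_unif eps k u v : walk_prob e K eps k u v - n%:R^-1 =
  \sum_(i | i != i0) g i u * walk_mode d l eps (mu i) k * f i v.
Proof.
rewrite walk_prob_modes (bigD1 i0)//= hi0 walk_mode_top// mulr1 top_projection//.
by rewrite addrAC subrr add0r.
Qed.

(** Inverts the expansion by duality, so that a large mode forces a large entry: modes cannot cancel
    each other in all entries at once. *)
Lemma walk_mode_entries eps k i : i != i0 -> walk_mode d l eps (mu i) k =
  \sum_(p : T * T) f i p.1 * (walk_prob e K eps k p.1 p.2 - n%:R^-1) * g i p.2.
Proof.
move=> ii0; rewrite -(pair_bigA _ (fun u v => f i u * (walk_prob e K eps k u v - n%:R^-1) * g i v)) /=.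
have E u v : f i u * (walk_prob e K eps k u v - n%:R^-1) * g i v =
    \sum_(j | j != i0) (f i u * g j u) * (walk_mode d l eps (mu j) k * (f j v * g i v)).
  rewrite walk_prob_sub_unif mulr_sumr mulr_suml; apply: eq_bigr => j _; ring.
under eq_bigr do under eq_bigr do rewrite E.
under eq_bigr do rewrite exchange_big /=.
rewrite exchange_big /= (bigD1 i)//=.
under eq_bigr do rewrite -!mulr_sumr hfg eqxx.
rewrite -mulr_suml hfg eqxx mul1r mulr1 big1 ?addr0// => j /andP[_ ji].
by under eq_bigr do rewrite -!mulr_sumr hfg (negPf ji) !mulr0; rewrite big1.
Qed.

(** Entries and modes are linear combinations of each other with coefficients independent of [k],
    and such constants do not affect the growth rate. *)
Lemma mixing_rate_modes (eps : R) (x0 : T) : eps <= d%:R^-1 ->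
  mixing_rate e K eps = \big[Num.max/0]_(i | i != i0) walk_rate d l eps (mu i).
Proof.
move=> heps; set r := \big[Num.max/0]_(i | _) _.
have growth i : i != i0 -> growth_rate (walk_mode d l eps (mu i)) (walk_rate d l eps (mu i)).
  by move=> ii0; apply: growth_rate_walk_mode => //; exact: not_top.
have r0 : 0 <= r by exact: bigmax_ge_id.
apply: (@limn_sup_root _ _ (fun k (p : T * T) => walk_prob e K eps k p.1 p.2 - n%:R^-1)) => //.
  move=> y ry.
  have bound i : {C | i != i0 -> forall k, `|walk_mode d l eps (mu i) k| <= C * y ^+ k}.
    apply: cid; case: (eqVneq i i0) => [_|ii0]; first by exists 0.
    have [up _] := growth i ii0; have [|C hC] := up y; last by exists C.
    apply: le_lt_trans ry; exact: (le_bigmax_cond _ (fun i => walk_rate d l eps (mu i))).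
  exists (\sum_(i | i != i0) (\sum_u `|g i u|) * `|sval (bound i)| * (\sum_v `|f i v|)).
  move=> k [u v] /=; rewrite walk_prob_sub_unif mulr_suml.
  apply: le_trans (ler_norm_sum _ _ _) _; apply: ler_sum => i ii0.
  set G := \sum_u0 _; set F := \sum_v0 _.
  have gG : `|g i u| <= G by rewrite /G (bigD1 u)//= lerDl sumr_ge0.
  have fF : `|f i v| <= F by rewrite /F (bigD1 v)//= lerDl sumr_ge0.
  have -> : G * `|sval (bound i)| * F * y ^+ k = G * (`|sval (bound i)| * y ^+ k) * F by ring.
  rewrite !normrM; apply: ler_pM => //.
  apply: ler_pM => //; apply: le_trans (svalP (bound i) ii0 k) _.
  by rewrite ler_wpM2r ?ler_norm// exprn_ge0// (le_trans r0)// ltW.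
(* An index other than [i0] exists, so the maximum is the rate of an actual mode and not the default
   0. *)
have [j jD _] := exists_not_bottom x0.
have jtop : j != i0 by apply: contra_neq jD => ->.
have [i ii0 rE] := @eq_bigmax _ R 'I_n 0 j (fun i => i != i0)
  (fun i => walk_rate d l eps (mu i)) jtop (fun i _ => walk_rate_ge0 d hl eps (mu i)).
have [_ [c c0 low]] := growth i ii0.
pose B : R := 1 + \sum_(p : T * T) `|f i p.1| * `|g i p.2|.
have B0 : 0 < B by rewrite ltr_pwDl// sumr_ge0// => p _; rewrite mulr_ge0.
exists (c / B) => [|N]; first exact: divr_gt0.
have [k Nk ck] := low N; exists k => //.
(* The entry of largest deviation at time [k] dominates the mode up to the factor [B]. *)
have [p _ pmax] := @arg_maxP _ R _ (x0, x0) xpredT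
  (fun p : T * T => `|walk_prob e K eps k p.1 p.2 - n%:R^-1|) isT.
exists p; rewrite mulrAC ler_pdivrMr//; move: ck; rewrite -rE -/r => /le_trans; apply.
rewrite walk_mode_entries//; apply: le_trans (ler_norm_sum _ _ _) _.
rewrite /B mulrDr mulr1 mulr_sumr -[X in X <= _]add0r lerD//.
apply: ler_sum => q _; rewrite !normrM mulrAC mulrC ler_wpM2r ?mulr_ge0//.
exact: pmax.
Qed.

Lemma walk_converges (eps : R) : 0 <= eps -> eps <= d%:R^-1 -> (3 <= d)%N || (3 <= l)%N ->
  ~ bipartite_graph e -> converges_to_uniform e K eps.
Proof.
move=> e0 e1 dl nbip u v.
suff h : (walk_prob e K eps k u v - n%:R^-1) @[k --> \oo] --> (0 : R).
  have -> : (fun k => walk_prob e K eps k u v) =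
      fun k => (walk_prob e K eps k u v - n%:R^-1) + n%:R^-1.
    by apply/funext => k; rewrite subrK.
  by rewrite -[X in _ --> X]add0r; apply: cvgD h _; exact: cvg_cst.
have -> : (fun k => walk_prob e K eps k u v - n%:R^-1) =
    fun k => \sum_(i | i != i0) g i u * walk_mode d l eps (mu i) k * f i v.
  by apply/funext => k; rewrite walk_prob_sub_unif.
rewrite [X in _ --> X](_ : _ = \sum_(i | i != i0) (0 : R)); last by rewrite big1.
apply: cvg_big => [|i ii0]; first exact: add_continuous.
rewrite -[X in _ --> X](mul0r (f i v)); apply: cvgMr_tmp.
rewrite -[X in _ --> X](mulr0 (g i u)); apply: cvgMl_tmp.
have [[x fx] _] := eigenbasis_neq0 i.
apply: (growth_rate_cvg0 (walk_rate_ge0 d hl eps (mu i))); last first.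
  by apply: growth_rate_walk_mode => //; exact: not_top.
apply: walk_rate_lt1 => //.
- apply: (eigenvalue_ge_Nd hG hK (hf i) fx).
- by rewrite lt_neqAle not_top//=; apply: (eigenvalue_le_degree hl hG hK (hf i) fx).
- apply/eqP => muD; apply: nbip.
  apply: (eigenvalue_opp_degree hl hG hconn hK (hf i) fx muD).
Qed.

End MixingRate.

(** * The rate in terms of [psi] and [delta] *)

Section RateFormula.
Variable R : realType.

(** Substituting [X = sqrt s * Y] turns [X^2 - x X + s] into a multiple of [Y^2 - 2 u Y + 1] with
    [u = x / (2 sqrt s)], whose larger root modulus is [psi u]. *)
Lemma psi_root_radius (x s : R) : 0 < s -> 0 <= x ->
  Num.sqrt s * psi (x / (2 * Num.sqrt s)) = root_radius x s.
Proof.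
move=> s0 x0; have r0 : 0 < Num.sqrt s by rewrite sqrtr_gt0.
have sE : (2 * Num.sqrt s) ^+ 2 = 4 * s by rewrite exprMn sqr_sqrtr ?(ltW s0)// -natrX.
have r2 : 0 < 2 * Num.sqrt s by rewrite mulr_gt0.
rewrite /psi ler_pdivrMr// mul1r; case: leP => h.
  by rewrite mulr1 root_radius_nonreal ?(ltW s0)// -sE lerXn2r ?nnegrE ?(ltW r2).
have xs : 4 * s <= x ^+ 2 by rewrite -sE lerXn2r ?nnegrE ?(ltW r2) ?(ltW h).
rewrite root_radius_real ?(ltW s0)// ger0_norm//.
have -> : x ^+ 2 - 4 * s = (2 * Num.sqrt s) ^+ 2 * ((x / (2 * Num.sqrt s)) ^+ 2 - 1).
  by rewrite -sE; field; rewrite gt_eqF.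
rewrite sqrtrM ?sqr_ge0// sqrtr_sqr gtr0_norm//.
by field; rewrite gt_eqF.
Qed.

Lemma root_radius_norm (t s : R) : root_radius `|t| s = root_radius t s.
Proof. by rewrite /root_radius normr_id real_normK ?num_real. Qed.

Lemma root_radius_opp_sum (z w : R) : 0 <= w -> w <= z ->
  root_radius (- (z + w)) (z * w) = z.
Proof.
move=> w0 wz; have z0 := le_trans w0 wz.
have e : (- (z + w)) ^+ 2 - 4 * (z * w) = (z - w) ^+ 2 by ring.
rewrite root_radius_real ?mulr_ge0//; last by rewrite -subr_ge0 e sqr_ge0.
have -> : `|- (z + w)| = z + w by rewrite normrN ger0_norm// addr_ge0.
by rewrite e sqrtr_sqr ger0_norm ?subr_ge0//; field.
Qed.

Variables (d l : nat).
Hypotheses (hd : (2 <= d)%N) (hl : (2 <= l)%N).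
Variable eps : R.
Hypothesis eps_lt : eps < d%:R^-1.
Let delta := eps * (d%:R - 1) / (1 - eps).
Let c := (l%:R - 2) * (1 - delta).
Let s := turn_det d l eps.
Let b : R := (1 - eps) / ((d%:R - 1) * (l%:R - 1)).

Let l1_gt0 : 0 < l%:R - 1 :> R. Proof. by rewrite subr_gt0 ltr1n. Qed.
Let d1_gt0 : 0 < d%:R - 1 :> R. Proof. by rewrite subr_gt0 ltr1n. Qed.
Let d_gt0 : 0 < d%:R :> R. Proof. by rewrite ltr0n ltnW. Qed.

Let eps1_gt0 : 0 < 1 - eps.
Proof. by rewrite subr_gt0 (lt_trans eps_lt)// invf_lt1// ltr1n. Qed.

Let s_gt0 : 0 < s. Proof. exact: turn_det_gt0. Qed.

Let b_gt0 : 0 < b. Proof. by rewrite divr_gt0// mulr_gt0. Qed.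

Let delta1 : 1 - delta = (1 - d%:R * eps) / (1 - eps).
Proof. by rewrite /delta; field; rewrite gt_eqF. Qed.

Let delta2 : d%:R - 1 + delta = (d%:R - 1) / (1 - eps).
Proof. by rewrite /delta; field; rewrite gt_eqF. Qed.

(** In terms of [eps] the prefactor is [sqrt s] and the radicand inside [psi] is [s / b^2]. *)
Lemma rate_formula L : 0 <= L ->
  Num.sqrt ((1 - delta) / ((d%:R - 1 + delta) * (l%:R - 1)))
    * psi (L / (2 * Num.sqrt ((l%:R - 1) * (1 - delta) * (d%:R - 1 + delta))))
  = root_radius (b * L) s.
Proof.
move=> L0; rewrite delta1 delta2.
have -> : (1 - d%:R * eps) / (1 - eps) / ((d%:R - 1) / (1 - eps) * (l%:R - 1)) = s.
  by rewrite /s /turn_det; field; rewrite !gt_eqF.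
have -> : (l%:R - 1) * ((1 - d%:R * eps) / (1 - eps)) * ((d%:R - 1) / (1 - eps)) =
    s * b^-1 ^+ 2.
  by rewrite /s /turn_det /b; field; rewrite !gt_eqF.
rewrite (@sqrtrM _ s) ?(ltW s_gt0)// sqrtr_sqr gtr0_norm ?invr_gt0//.
rewrite -(psi_root_radius s_gt0 (mulr_ge0 (ltW b_gt0) L0)); congr (_ * psi _).
by field; rewrite !gt_eqF// sqrtr_gt0.
Qed.

(** Since [1 - delta = s / b], the shift [c] is [(l - 2) s / b] and the trace is [b * (mu - c)]. *)
Let traceE mu : root_radius (turn_trace d l eps mu) s = root_radius (b * `|mu - c|) s.
Proof.
have -> : turn_trace d l eps mu = b * (mu - c).
  rewrite /turn_trace /turn_det /c delta1 /b; field; by rewrite !gt_eqF.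
by rewrite -root_radius_norm normrM (gtr0_norm b_gt0).
Qed.

Lemma walk_rate_not_bottom mu : mu != - d%:R ->
  walk_rate d l eps mu = root_radius (b * `|mu - c|) s.
Proof. by rewrite /walk_rate => /negPf ->. Qed.

(** The right side compares the moduli of the two roots at [mu = - d]. *)
Let crit : (l%:R * (1 - delta) <= d%:R) = (s * (l%:R - 1) <= (l%:R - 1)^-1).
Proof.
rewrite delta1 mulrA ler_pdivrMr//.
have -> : s * (l%:R - 1) = (1 - d%:R * eps) / (d%:R - 1).
  by rewrite /s /turn_det; field; rewrite !gt_eqF.
rewrite ler_pdivrMr// ler_pdivlMl//.
by apply/idP/idP; lra.
Qed.

Lemma walk_rate_dominant_bottom mu : l%:R * (1 - delta) <= d%:R ->
  walk_rate d l eps mu = root_radius (b * `|mu - c|) s.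
Proof.
rewrite crit => h; have [->|] := eqVneq mu (- d%:R); last exact: walk_rate_not_bottom.
rewrite /walk_rate eqxx -traceE.
have -> : turn_trace d l eps (- d%:R) = - ((l%:R - 1)^-1 + s * (l%:R - 1)).
  by rewrite /turn_trace /s /turn_det; field; rewrite !gt_eqF.
rewrite -[X in _ = root_radius _ X](_ : (l%:R - 1)^-1 * (s * (l%:R - 1)) = _).
  by rewrite root_radius_opp_sum// mulr_ge0 ?(ltW s_gt0) ?(ltW l1_gt0).
by field; rewrite gt_eqF.
Qed.

Lemma walk_rate_recessive_bottom t : d%:R < l%:R * (1 - delta) ->
  walk_rate d l eps (- d%:R) <= root_radius t s.
Proof.
rewrite ltNge crit -ltNge => h; rewrite /walk_rate eqxx.
apply: le_trans (sqrt_le_root_radius t s).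
rewrite -ler_sqr ?nnegrE ?sqrtr_ge0 ?invr_ge0 ?(ltW l1_gt0)//.
rewrite sqr_sqrtr ?(ltW s_gt0)// expr2 ler_pdivrMr//; exact: ltW.
Qed.

End RateFormula.

(** * The sorted list of eigenvalues without its largest member *)

Section SpectrumTail.
Variable R : realType.

Lemma sorted_ge_head (x y : R) s : path >=%R x s -> y \in x :: s -> y <= x.
Proof.
move=> /order_path_min h; rewrite inE => /orP[/eqP -> //|].
by move/allP: (h (fun a b c' ba ac => le_trans ac ba)); apply.
Qed.

Lemma sorted_ge_last (x y : R) s : path >=%R x s -> y \in x :: s -> last x s <= y.
Proof.
elim: s x => [|z s IH] x /=; first by rewrite inE => _ /eqP ->.
move=> /andP[zx zs]; rewrite inE => /orP[/eqP ->|ys]; last exact: IH.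
by apply: le_trans zx; apply: sorted_ge_head zs _; exact: mem_last.
Qed.

(** Matches the list [lambda_2, ..., lambda_n] of the formulas with the indices [i != i0] of the
    eigenbasis, as multisets. *)
Lemma spectrum_tail n (mu : 'I_n -> R) (lam : seq R) i0 :
    perm_eq [seq mu i | i <- enum 'I_n] lam -> sorted >=%R lam ->
    (forall i, mu i <= mu i0) ->
  exists2 lam', lam = mu i0 :: lam' &
    perm_eq [seq mu i | i <- enum 'I_n & i != i0] lam'.
Proof.
move=> pm srt top.
have i0lam : mu i0 \in lam by rewrite -(perm_mem pm) map_f ?mem_enum.
case: lam pm srt i0lam => // x s pm srt i0lam.
have xE : x = mu i0.
  apply/eqP; rewrite eq_le (sorted_ge_head srt i0lam) andbT.
  have : x \in x :: s := mem_head _ _.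
  by rewrite -(perm_mem pm) => /mapP[i _ ->].
exists s; rewrite ?xE// -(perm_cons (mu i0)) -[in X in perm_eq _ X]xE.
apply: perm_trans pm; rewrite perm_sym.
rewrite -[_ :: _]/[seq mu i | i <- i0 :: [seq i <- enum 'I_n | i != i0]].
apply: perm_map; rewrite -(rem_filter _ (enum_uniq _)).
by apply: perm_to_rem; rewrite mem_enum.
Qed.

End SpectrumTail.

Lemma bigmax_eq (R : realType) (I : finType) (P : pred I) (F : I -> R) (x : R) :
    (forall i, P i -> F i <= x) -> 0 <= x -> (exists2 i, P i & F i = x) ->
  \big[Num.max/0]_(i | P i) F i = x.
Proof.
move=> ub x0 [i Pi Fi]; apply/eqP; rewrite eq_le -{2}Fi le_bigmax_cond// andbT.
exact: bigmax_le.
Qed.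

(** [eig] counts from 1, so [x] sits at index 1 and the range from 2 to [size s + 1] runs exactly
    through [s]. *)
Lemma bigmax_eig_behead (R : realType) (x : R) (s : seq R) (P : pred R) (F : R -> R) :
  \big[Num.max/0]_(2 <= i < (size s).+2 | P (eig (x :: s) i)) F (eig (x :: s) i) =
  \big[Num.max/0]_(y <- s | P y) F y.
Proof. by rewrite [RHS](big_nth 0) !big_add1. Qed.

(** * From the maximum over eigenvalues to the formulas of the two cases *)

Theorem theorem1p2 (R : realType) (T : finType) (e : rel T)
    (K : {set {set T}}) (d l : nat) (lam : seq R) (eps : R)
    (hd : (2 <= d)%N) (hl : (2 <= l)%N)
    (heps0 : 0 <= eps) (heps1 : eps < d%:R^-1)
    (hG : simple_graph e)
    (hconn : connected_graph e)
    (hncomp : ~ complete_graph e)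
    (hnbip : ~ bipartite_graph e)
    (hK : clique_partition e d l K)
    (hlam : is_spectrum (adjacency_matrix R e) lam) :
  let n := #|T| in
  let delta := eps * (d%:R - 1) / (1 - eps) in
  let c := (l%:R - 2) * (1 - delta) in
  let lambda := Num.max `|eig lam 2 - c| `|eig lam n - c| in
  let hat_lambda :=
    \big[Num.max/0]_(2 <= i < n.+1 | eig lam i != - d%:R) `|eig lam i - c| in
  (l%:R * (1 - delta) <= d%:R -> (3 <= d)%N ->
     [/\ converges_to_uniform e K eps,
         mixing_rate e K eps
         = Num.sqrt ((1 - delta) / ((d%:R - 1 + delta) * (l%:R - 1)))
           * psi (lambda /
               (2 * Num.sqrt ((l%:R - 1) * (1 - delta) * (d%:R - 1 + delta))))
       & {within `[0, d%:R^-1],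
            continuous (fun eps' : R => mixing_rate e K eps')}])
  /\
  (l%:R * (1 - delta) > d%:R ->
     converges_to_uniform e K eps
     /\ mixing_rate e K eps
        = Num.sqrt ((1 - delta) / ((d%:R - 1 + delta) * (l%:R - 1)))
          * psi (hat_lambda /
              (2 * Num.sqrt ((l%:R - 1) * (1 - delta) * (d%:R - 1 + delta))))).
Proof.
move=> n delta c lambda hat_lambda.
(* An empty graph would be bipartite. *)
have [x0 _] : exists x0 : T, xpredT x0.
  apply/existsP; apply: contra_notT hnbip => /existsPn h.
  by exists xpredT => x; case/negP: (h x).
have [mu [f [g [pm hf hg hfg hgf]]]] := adjacency_diagonalization hG hlam.
have [i0 hi0] := exists_top hl hG hK hg hgf x0.
have [j jtop jbot] := exists_not_bottom hd hl hG hK hf hg hgf x0.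
have ji0 : j != i0 by apply: contra_neq jtop => ->.
have mu_le i : mu i <= mu i0.
  have [[x fx] _] := eigenbasis_neq0 hfg i.
  by rewrite hi0; apply: (eigenvalue_le_degree hl hG hK (hf i) fx).
have [lam' lamE pm'] := spectrum_tail pm hlam.1 mu_le.
have conv : (3 <= d)%N || (3 <= l)%N -> converges_to_uniform e K eps.
  by move=> h; apply: (walk_converges hd hl hG hconn hK hf hg hfg hgf hi0) => //; exact: ltW.
have rate eps' : eps' <= d%:R^-1 -> mixing_rate e K eps' =
    \big[Num.max/0]_(i | i != i0) walk_rate d l eps' (mu i).
  exact: (mixing_rate_modes hd hl hG hconn hK hf hg hfg hgf hi0 x0).
pose b : R := (1 - eps) / ((d%:R - 1) * (l%:R - 1)).
have d1 : 0 < d%:R - 1 :> R by rewrite subr_gt0 ltr1n.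
have b0 : 0 <= b.
  rewrite divr_ge0 ?mulr_ge0 ?(ltW d1) ?subr_ge0 ?ler1n ?(ltnW hl)//.
  by rewrite (le_trans (ltW heps1))// invf_le1 ?ltr0n ?ler1n// ltnW.
have mono x y : x <= y -> 0 <= x ->
    root_radius (b * x) (turn_det d l eps) <= root_radius (b * y) (turn_det d l eps).
  move=> xy x_ge0; apply: le_root_radius.
  by rewrite !normrM ler_wpM2l// !ger0_norm// (le_trans x_ge0).
have mem_lam' x : x \in lam' -> exists2 i, i != i0 & mu i = x.
  rewrite -(perm_mem pm') => /mapP[i]; rewrite mem_filter => /andP[ii0 _] ->.
  by exists i.
have lam'_mu i : i != i0 -> mu i \in lam'.
  by move=> ii0; rewrite -(perm_mem pm') map_f// mem_filter ii0 mem_enum.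
have size_lam : n = (size lam').+1.
  by rewrite -[RHS]/(size (mu i0 :: lam')) -lamE -(perm_size pm) size_map size_enum_ord.
split=> [bot d3|bot].
  split; first by apply: conv; rewrite d3.
    rewrite rate ?(ltW heps1)// (rate_formula hd hl heps1) ?le_max ?normr_ge0//.
    have walkE x : walk_rate d l eps x = root_radius (b * `|x - c|) (turn_det d l eps).
      exact: walk_rate_dominant_bottom.
    have : (0 < size lam')%N by rewrite -has_predT; apply/hasP; exists (mu j); rewrite ?lam'_mu.
    case lamE' : lam' => [//|x s] _.
    have lambdaE : lambda = Num.max `|x - c| `|last x s - c|.
      rewrite /lambda /eig lamE size_lam lamE' /=; congr (Num.max _ `|_ - c|).
      exact: (nth_last 0 (x :: s)).
    have srt : path >=%R x s.
      by have := hlam.1; rewrite lamE lamE' /= => /andP[].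
    have hx : x \in lam' by rewrite lamE' mem_head.
    have hy : last x s \in lam' by rewrite lamE' mem_last.
    (* The rate grows with [|mu i - c|], which over the sorted tail is largest at one of its ends,
       [lambda_2] or [lambda_n]. *)
    apply: bigmax_eq => [i ii0||]; [|exact: root_radius_ge0|].
      rewrite walkE; apply: mono => //.
      have := lam'_mu _ ii0; rewrite lamE' => hi.
      have h1 := sorted_ge_head srt hi; have h2 := sorted_ge_last srt hi.
      rewrite lambdaE le_max; case: (ger0P (mu i - c)) => _.
        by apply/orP; left; apply: le_trans (ler_norm _); rewrite lerD2r.
      apply/orP; right; rewrite distrC; apply: le_trans (ler_norm _).
      by rewrite opprB lerD2l lerN2.
    have [ix ix0 ixE] := mem_lam' _ hx; have [iy iy0 iyE] := mem_lam' _ hy.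
    case: (leP `|x - c| `|last x s - c|) => h.
      by exists iy => //; rewrite walkE iyE lambdaE (max_idPr h).
    by exists ix => //; rewrite walkE ixE lambdaE (max_idPl (ltW h)).
  (* On the whole closed interval the mixing rate is a finite maximum of continuous functions of
     [eps']. *)
  apply: (@subspace_eq_continuous _ _ _
    (fun eps' => \big[Num.max/0]_(i | i != i0) walk_rate d l eps' (mu i))).
    by move=> y; rewrite inE /= in_itv /= => /andP[_ y1]; exact/esym/rate.
  apply: continuous_subspaceT; apply: continuous_big => [|i _]; first exact: max_continuous.
  exact: walk_rate_continuous.
(* For [l = 2] the second case is void, as [2 (1 - delta) <= 2 <= d]. *)
have l3 : (3 <= l)%N.
  rewrite ltnNge; apply/negP => l2; move: bot; apply/negP; rewrite -leNgt.
  have -> : l = 2%N by apply/eqP; rewrite eqn_leq l2 hl.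
  have delta0 : 0 <= delta.
    rewrite divr_ge0 ?mulr_ge0 ?(ltW d1)// subr_ge0.
    by rewrite (le_trans (ltW heps1))// invf_le1 ?ltr0n ?ler1n// ltnW.
  by have : 2 <= d%:R :> R; [rewrite ler_nat | lra].
split; first by apply: conv; rewrite l3 orbT.
have hatE : hat_lambda =
    \big[Num.max/0]_(i | (i != i0) && (mu i != - d%:R)) `|mu i - c|.
  transitivity (\big[Num.max/0]_(x <- lam' | x != - d%:R) `|x - c|).
    rewrite /hat_lambda size_lam lamE.
    exact: (bigmax_eig_behead _ _ (fun x => x != - d%:R) (fun x => `|x - c|)).
  rewrite -(perm_big _ pm') big_map big_filter_cond big_enum_cond.
  exact: eq_bigl.
have hat0 : 0 <= hat_lambda by rewrite hatE bigmax_ge_id.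
rewrite rate ?(ltW heps1)// (rate_formula hd hl heps1)//.
have walkE x : x != - d%:R ->
    walk_rate d l eps x = root_radius (b * `|x - c|) (turn_det d l eps).
  exact: walk_rate_not_bottom.
apply: bigmax_eq => [i ii0||]; [|exact: root_radius_ge0|].
  (* The rate [1 / (l - 1)] of the eigenvalue [- d] lies below every [root_radius] here, so leaving
     it out of [hat_lambda] does not change the maximum. *)
  have [->|ib] := eqVneq (mu i) (- d%:R).
    exact: walk_rate_recessive_bottom.
  rewrite walkE//; apply: mono => //; rewrite hatE.
  by apply: (le_bigmax_cond _ (fun i => `|mu i - c|)); rewrite ii0.
(* The index [j] makes the range of [hat_lambda] nonempty, so its maximum is attained. *)
have jP : (j != i0) && (mu j != - d%:R) by rewrite ji0.
have [i /andP[ii0 ib] hE] := @eq_bigmax _ R 'I_n 0 j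
  (fun i => (i != i0) && (mu i != - d%:R)) (fun i => `|mu i - c|) jP
  (fun i _ => normr_ge0 _).
by exists i => //; rewrite walkE// hatE hE.
Qed.
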